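(* Let $B^H$ be a $d$-dimensional fractional Brownian motion of Hurst index $H\in(0,1)$ and let $I=[\varepsilon_0,1]$ with $\varepsilon_0\in(0,1)$ fixed. Let $E\subset I$ be a compact set which is $\beta$-regular for some $\beta\in(0,1]$, i.e. there exist a finite positive Borel measure $\nu$ supported on $E$ and a positive constant $\mathfrak{c}_9$ such that $$\mathfrak{c}_9^{-1}\delta^\beta\le\nu([a-\delta,a+\delta])\le\mathfrak{c}_9\,\delta^\beta\quad\text{for all }a\in E,\ 0<\delta\le1.$$ Let $F\subset\mathbb{R}^d$ be a compact set such that $\dim(F)\le d-\beta/H$. Then for all $0<\alpha<\dfrac{\beta}{d-\dim(F)}$ and for all $\varepsilon>0$ small enough such that $\mathcal{C}_{d-\beta/(\alpha+\varepsilon)}(F)>0$, there exists an $\alpha$-Hölder continuous function $f:[0,1]\to\mathbb{R}^d$ satisfying $$\mathbb{P}\{(B^H+f)(E)\cap F\neq\emptyset\}\ge \mathsf{c}_1\,\mathcal{C}_{d-\beta/(\alpha+\varepsilon)}(F),$$ where $\mathsf{c}_1$ is a positive constant which depends on $\alpha,\beta,H,d$ and $\varepsilon$ only.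
   Context: A $d$-dimensional fractional Brownian motion of Hurst index $H\in(0,1)$ is $B^H=(B^H_1,\dots,B^H_d)$ with independent components, each a real-valued centered Gaussian process with stationary increments and covariance $\mathbb{E}(B^H_i(s)B^H_i(t))=\frac12(|t|^{2H}+|s|^{2H}-|t-s|^{2H})$, defined on a complete probability space $(\Omega,\mathcal{F},\mathbb{P})$. $\dim$ is Hausdorff dimension (Euclidean metric). The Bessel–Riesz capacity of order $\gamma$ of $A\subset\mathbb{R}^d$ is $$\mathcal{C}_\gamma(A)=\Big[\inf_{\mu\in\mathcal{P}(A)}\iint\varphi_\gamma(\|x-y\|)\,\mu(dx)\mu(dy)\Big]^{-1},$$ where $\|\cdot\|$ is the Euclidean norm, $\mathcal{P}(A)$ is the family of probability measures carried by $A$ and, for $r>0$, $\varphi_\gamma(r)=r^{-\gamma}$ if $\gamma>0$, $\varphi_\gamma(r)=\log\big(\frac{e}{r\wedge1}\big)$ if $\gamma=0$, $\varphi_\gamma(r)=1$ if $\gamma<0$.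
   Formalization: The constant c_1 may also depend on an upper bound for the diameter of F (otherwise the claim fails by scaling F when d-β/(α+ε)>0), and B^H is assumed to have almost surely continuous paths so that the hitting event is measurable. *)

(* Defs.v *)
From HB Require Import structures.
From mathcomp Require Export all_boot all_order all_algebra.
From mathcomp Require Export all_classical all_reals all_analysis.

Set Implicit Arguments.
Unset Strict Implicit.
Unset Printing Implicit Defensive.

Export Order.TTheory GRing.Theory Num.Theory.
Export numFieldNormedType.Exports.

#[export] Set Implicit Arguments.
#[export] Unset Strict Implicit.
#[export] Unset Printing Implicit Defensive.

Local Open Scope classical_set_scope.
Local Open Scope ring_scope.

(* The library norm on 'rV[R]_d is the sup norm. It induces the same topology
   (hence the same compact and Borel sets) as the Euclidean norm, but metric
   quantities below use the Euclidean one. *)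
Definition enorm (R : realType) (d : nat) (x : 'rV[R]_d) : R :=
  Num.sqrt (\sum_(i < d) x 0 i ^+ 2).

(* The extra 0 makes the diameter of the empty set 0. *)
Definition ediam (R : realType) (d : nat) (A : set 'rV[R]_d) : \bar R :=
  ereal_sup ([set (enorm (p.1 - p.2))%:E | p in A `*` A] `|` [set 0%E]).

Definition hausdorff_premeasure (R : realType) (d : nat) (s delta : R)
    (A : set 'rV[R]_d) : \bar R :=
  ereal_inf
    [set (\sum_(0 <= n <oo) if U n == set0 then 0 else ediam (U n) `^ s)%E
    | U in [set U : nat -> set 'rV[R]_d |
        A `<=` \bigcup_n U n /\ forall n, (ediam (U n) <= delta%:E)%E]].

Definition hausdorff_measure (R : realType) (d : nat) (s : R)
    (A : set 'rV[R]_d) : \bar R :=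
  ereal_sup [set hausdorff_premeasure s delta A
            | delta in [set delta : R | 0 < delta]].

Definition hausdorff_dim (R : realType) (d : nat) (A : set 'rV[R]_d) : \bar R :=
  ereal_inf [set s%:E
            | s in [set s : R | 0 <= s /\ hausdorff_measure s A = 0%E]].

Definition borelRd (R : realType) (d : nat) :=
  g_sigma_algebraType (@open 'rV[R]_d).

(* At r = 0, which matters for measures charging the diagonal, the kernel takes
   its limit as r tends to 0 from the right. *)
Definition riesz_kernel (R : realType) (gamma r : R) : \bar R :=
  if gamma < 0 then 1%E
  else if r == 0 then +oo%E
  else if gamma == 0 then (ln (expR 1 / Num.min r 1))%:E
  else (r `^ (- gamma))%:E.

Definition riesz_energy (R : realType) (d : nat) (gamma : R)
    (mu : probability (borelRd R d) R) : \bar R :=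
  (\int[mu]_x \int[mu]_y
     riesz_kernel gamma (enorm ((x : 'rV[R]_d) - (y : 'rV[R]_d))))%E.

(* The extended inverse satisfies 0^-1 = +oo and +oo^-1 = 0; in particular the
   empty set has capacity 0. *)
Definition riesz_capacity (R : realType) (d : nat) (gamma : R)
    (A : set 'rV[R]_d) : \bar R :=
  ((ereal_inf [set riesz_energy gamma mu
     | mu in [set mu : probability (borelRd R d) R |
         mu.-negligible (~` A)]])^-1)%E.

(* nu is required to be nonzero: otherwise the empty set would be regular. *)
Definition beta_regular (R : realType) (beta : R) (E : set R) : Prop :=
  exists (nu : {finite_measure set (measurableTypeR R) -> \bar R}) (c : R),
    [/\ 0 < c, (0 < nu setT)%E, nu.-negligible (~` E) &
      forall a delta : R, E a -> 0 < delta <= 1 ->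
        ((c^-1 * delta `^ beta)%:E <= nu `[(a - delta)%R, (a + delta)%R]%classic
           <= (c * delta `^ beta)%:E)%E].

Definition holder_on01 (R : realType) (d : nat) (alpha : R)
    (f : R -> 'rV[R]_d) : Prop :=
  exists K : R, forall s t : R, 0 <= s <= 1 -> 0 <= t <= 1 ->
    enorm (f s - f t) <= K * `|s - t| `^ alpha.

Section processes.
Context (R : realType) (disp : measure_display) (T : measurableType disp).
Variable P : probability T R.

(* normal_prob m 0 is not the degenerate Gaussian law, hence the Dirac case. *)
Definition has_normal_law (Y : T -> R) (m s : R) : Prop :=
  measurable_fun setT Y /\
  forall A : set (measurableTypeR R), measurable A ->
    P (Y @^-1` A) = if s == 0 then dirac m A else normal_prob m s A.

(* Processes are indexed by nonnegative times; values at negative times are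
   irrelevant. *)
Definition gaussian_process (X : R -> T -> R) : Prop :=
  forall (n : nat) (t a : 'I_n -> R), (forall k, 0 <= t k) ->
    exists m s : R, has_normal_law (fun w => \sum_(k < n) a k * X (t k) w) m s.

Definition stationary_increments (X : R -> T -> R) : Prop :=
  forall (h : R) (n : nat) (t : 'I_n -> R)
      (A : 'I_n -> set (measurableTypeR R)),
    0 <= h -> (forall k, 0 <= t k) -> (forall k, measurable (A k)) ->
    P [set w | forall k, A k (X (t k + h) w - X h w)] =
    P [set w | forall k, A k (X (t k) w - X 0 w)].

Record is_fbm1 (H : R) (X : R -> T -> R) : Prop := IsFbm1 {
  fbm1_gaussian : gaussian_process X ;
  fbm1_centered : forall t : R, 0 <= t -> ('E_P[X t] = 0)%E ;
  fbm1_stationary : stationary_increments X ;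
  fbm1_cov : forall s t : R, 0 <= s -> 0 <= t ->
    ('E_P[(fun w => X s w * X t w)%R] =
    (2^-1 * (`|t| `^ (2 * H) + `|s| `^ (2 * H) - `|t - s| `^ (2 * H)))%R%:E)%E }.

Definition sigma_process (X : R -> T -> R) : set (set T) :=
  <<s [set X t @^-1` A | t in [set t : R | 0 <= t]
                       & A in (@measurable _ (measurableTypeR R))] >>.

Definition independent_processes (d : nat) (X : 'I_d -> R -> T -> R) : Prop :=
  forall C : 'I_d -> set T, (forall i, sigma_process (X i) (C i)) ->
    P [set w | forall i, C i w] = (\prod_(i < d) P (C i))%E.

(* Almost sure path continuity is part of the usual definition; without it the
   hitting events need not be measurable. *)
Record is_fbm (d : nat) (H : R) (B : R -> T -> 'rV[R]_d) : Prop := IsFbm {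
  fbm_components : forall i, is_fbm1 H (fun t w => B t w 0 i) ;
  fbm_independent : independent_processes (fun i t w => B t w 0 i) ;
  fbm_continuous : {ae P, forall w,
    {within [set t : R | 0 <= t], continuous (fun t => B t w)}} }.

End processes.

(* Main.v *)
Require Import Defs.
From mathcomp Require Import ring lra measurable_realfun.

Local Open Scope classical_set_scope.
Local Open Scope ring_scope.

(** The dimension hypotheses give [alpha < H]: since [dim F <= d - beta / H], one
    has [beta / (d - dim F) <= H]. The theorem is then a statement on functions
    which are rougher than the paths of [B], and [f] is found by randomisation.
    Put [q = 2 ^ - alpha], let [nu] be the regular measure on [E], localised as
    explained below on a ball with centre [a] and radius [r], and let
    [u = (t - a) / (2 r)]. Each coordinate of [f] is a constant plus
      [L xi + sum_(n <= N) q ^ n (V_n cos (pi 2 ^ n u) + V'_n sin (pi 2 ^ n u))],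
    where [xi], [V_n], [V'_n] are independent and uniform on a fine finite grid
    of the unit interval, so that expectations over [f] are averages over a
    finite set. Three features of this sum matter ([lac], [lacf]).

    - The shift [L xi] makes the value of [f] at one point close to uniformly
      distributed on a box which is large enough to contain all the targets
      [x - B t], whence a lower bound of order [eta ^ d] for the probability that
      [B t + f t] is within [eta = q ^ N] of [x] ([avg_lacf_ge]).
    - If [u] and [v] are at distance about [2 ^ - m], the phases of the term
      [n = m] differ by at least a right angle, so that some coefficient of the
      increment is at least [q ^ m] ([lac_sep]), while the whole increment is at
      most a constant times [q ^ m] ([lac_osc]). Hence two targets are reached
      simultaneously with probability at most [(eta ^ 2 / q ^ m) ^ d] up to a
      constant, and this probability vanishes unless the targets differ by at
      most a constant times [q ^ m] ([avg_lacf2_le]).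
    - The bound [lac_osc] also makes [f] alpha-Holder, uniformly in [N]
      ([lac_holder]).

    For measures [nu] on [E] and [mu] on [F], let [Z] be the measure of the pairs
    [(t, x)] such that [B t + f t] is within [eta] of [x]. The second moment
    method bounds the probability that [Z] is positive from below by
    [(E Z) ^ 2 / E (Z ^ 2)]. By the above, [E (Z ^ 2)] is at most [eta ^ (2 d)]
    times a sum over the scales [m] of [q ^ (- m d)] times the probability that
    [B s - B t] is within a constant times [q ^ m] of [x - y], integrated over
    the pairs of times at distance [2 ^ - m]. There [B s - B t] is Gaussian with
    standard deviation at most of order [2 ^ (- m H) <= q ^ m], so this
    probability is at most a constant times [(q ^ m / |x - y|) ^ gamma'] for all
    [gamma'] in [[0, d]] ([fbm_near_le]). The mass of the pairs of times is of
    order [2 ^ (- m beta)], and for [gamma'] the positive part of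
    [gamma = d - beta / (alpha + eps)] the exponent
    [alpha (d - gamma') - beta] is negative: the scales sum up geometrically, and
    what remains is the [gamma]-energy of [mu] ([hitting_lower_bound]). Taking
    for [mu] a measure of nearly minimal energy produces the capacity.

    The constant must not depend on the regularity constant of [nu]. This is
    achieved by restricting [nu] to a ball on which [nu (ball a r) / r ^ beta] is
    nearly maximal, and by letting [f] live at the scale [r]
    ([beta_regular_localize]); only the Holder constant of [f] depends on [r].

    Both measures are replaced by finitely many weighted points ([time_net],
    [space_net]), so that the argument is carried out on finite sums and yields,
    for each [N], a function [f_N] for which the event of hitting [F] up to
    [q ^ N] has the required probability ([approx_hit]). The [f_N] are
    equicontinuous and bounded, hence have a uniform cluster point [f] on the
    unit interval ([holder_cluster]), and continuity of the paths and compactness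
    of [E] and [F] turn approximate hitting at all scales into hitting
    ([hit_prob_ge]). *)

(** * Averages over finite sets of coefficients *)

Section averages.
Context {R : realType}.

Definition avg (T : finType) (F : T -> R) : R := (\sum_x F x) / #|T|%:R.

Lemma le_avg (T : finType) (F G : T -> R) :
  (forall x, F x <= G x) -> avg F <= avg G.
Proof. by move=> FG; rewrite ler_wpM2r ?invr_ge0// ler_sum. Qed.

Lemma eq_avg (T : finType) (F G : T -> R) : F =1 G -> avg F = avg G.
Proof. by move=> FG; congr (_ / _); apply: eq_bigr => x _. Qed.

Lemma avgZ (T : finType) (F : T -> R) (a : R) :
  avg (fun x => a * F x) = a * avg F.
Proof. by rewrite /avg -mulr_sumr mulrA. Qed.

Lemma avg_cst (T : finType) (a : R) : (0 < #|T|)%N -> avg (fun _ : T => a) = a.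
Proof.
move=> T0; rewrite /avg sumr_const -[a *+ _]mulr_natr -mulrA divff ?mulr1//.
by rewrite pnatr_eq0 -lt0n.
Qed.

Lemma avg_sum (T I : finType) (F : I -> T -> R) :
  avg (fun x => \sum_i F i x) = \sum_i avg (F i).
Proof. by rewrite /avg exchange_big/= mulr_suml. Qed.

Lemma avg_ge0 (T : finType) (F : T -> R) : (forall x, 0 <= F x) -> 0 <= avg F.
Proof. by move=> F0; rewrite mulr_ge0 ?invr_ge0 ?sumr_ge0. Qed.

Lemma avg_le_ex (T : finType) (F : T -> R) (a : R) :
  (0 < #|T|)%N -> a <= avg F -> exists x, a <= F x.
Proof.
move=> T0 aF; apply: contrapT => /forallNP Fa.
move: aF; apply/negP; rewrite -ltNge /avg ltr_pdivrMr ?ltr0n//.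
rewrite mulr_natr -[X in _ < _ *+ X]/#|T| -sumr_const.
have [x0 _] := card_gt0P T0.
rewrite (bigD1 x0)//= [ltRHS](bigD1 x0)//=; apply: ltr_leD.
  by rewrite ltNge; exact/negP.
by apply: ler_sum => x _; rewrite ltW// ltNge; exact/negP.
Qed.

Lemma avg_prod (I T : finType) (F : I -> T -> R) :
  avg (fun V : {ffun I -> T} => \prod_i F i (V i)) = \prod_i avg (F i).
Proof.
rewrite /avg -(bigA_distr_bigA F) big_split/=; congr *%R.
by rewrite big_const card_ffun natrX -exprVn iter_mulr_1.
Qed.

Definition upd (J T : finType) (x : {ffun J -> T}) (j : J) (v : T) :=
  [ffun i => if i == j then v else x i].

Lemma updK (J T : finType) (x : {ffun J -> T}) j v : upd (upd x j v) j (x j) = x.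
Proof. by apply/ffunP => i; rewrite !ffunE; case: eqP => // ->. Qed.

Lemma sum_upd (J T : finType) (F : {ffun J -> T} -> R) (j : J) :
  \sum_x \sum_v F (upd x j v) = #|T|%:R * \sum_x F x.
Proof.
rewrite pair_big/=.
have sK : involutive (fun p : {ffun J -> T} * T => (upd p.1 j p.2, p.1 j)).
  by move=> [x v] /=; rewrite ffunE eqxx updK.
rewrite (reindex_inj (inv_inj sK))/=.
under eq_bigr => p _ do rewrite updK.
rewrite -(pair_big predT predT (fun x v => F x))/=.
under eq_bigr => x _ do rewrite sumr_const -mulr_natl.
by rewrite -mulr_sumr.
Qed.

(** Averaging over one coordinate first: this is how the independence of the
    coefficients is used. *)
Lemma avg_upd (J T : finType) (F : {ffun J -> T} -> R) (j : J) :
  (0 < #|T|)%N -> avg F = avg (fun x => avg (fun v => F (upd x j v))).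
Proof.
move=> T0; rewrite /avg -mulr_suml sum_upd [_%:R * _]mulrC mulfK//.
by rewrite pnatr_eq0 -lt0n.
Qed.

Lemma sum_bool_card (T : finType) (S : pred T) :
  \sum_v (S v)%:R = #|S|%:R :> R.
Proof.
rewrite -sum1_card natr_sum [RHS]big_mkcond; apply: eq_bigr => v _.
by rewrite unfold_in; case: (S v).
Qed.

Definition gridv (D : nat) (v : 'I_D.+1) : R := v%:R / D.+1%:R.

Lemma gridv_itv (D : nat) (v : 'I_D.+1) : 0 <= gridv v <= 1.
Proof.
rewrite /gridv divr_ge0//= ler_pdivrMr ?ltr0n// mul1r ler_nat.
exact: ltnW.
Qed.

(** The grid points in question lie in an interval; counting them costs one extra
    point, whence the term [D.+1%:R^-1]. *)
Lemma avg_grid_le (D : nat) (a y rho : R) : a != 0 -> 0 <= rho ->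
  avg (fun v : 'I_D.+1 => (`|a * gridv v - y| <= rho)%R%:R)
    <= 2 * rho / `|a| + D.+1%:R^-1.
Proof.
move=> a0 rho0; have a1 : 0 < `|a| by rewrite normr_gt0.
have D0 : 0 < D.+1%:R :> R by rewrite ltr0n.
rewrite /avg card_ord ler_pdivrMr// mulrDl mulVf ?gt_eqF//.
set l : R := 2 * rho / `|a| * D.+1%:R.
have l0 : 0 <= l by rewrite !mulr_ge0// ?invr_ge0.
pose S := [pred v : 'I_D.+1 | `|a * gridv v - y| <= rho].
have -> : \sum_(v < D.+1) (`|a * gridv v - y| <= rho)%R%:R = #|S|%:R :> R.
  exact: (sum_bool_card S).
have [[v Sv]|] := pselect (exists v, S v); last first.
  move=> /forallNP S0; rewrite (_ : #|S| = 0%N) ?addr_ge0//.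
  by apply: eq_card0 => v; apply/negbTE/negP; exact: S0.
case: (arg_minnP (val : 'I_D.+1 -> nat) Sv) => v0 Sv0 v0min {v Sv}.
have Sle v : S v -> (v - v0 <= Num.truncn l)%N.
  move=> Sv; have v0v := v0min _ Sv; rewrite truncn_ge_nat// natrB//.
  have : `|a * gridv v - a * gridv v0| <= 2 * rho.
    rewrite (_ : _ - _ = (a * gridv v - y) - (a * gridv v0 - y)); last by ring.
    by rewrite (le_trans (ler_normB _ _))// mulr_natl mulr2n lerD.
  rewrite -mulrBr normrM /gridv -mulrBl normrM normfV (ger0_norm (ltW D0)).
  rewrite [`|v%:R - _|]ger0_norm ?subr_ge0 ?ler_nat// /l => h.
  rewrite mulrAC ler_pdivlMr// mulrC.
  by move: h; rewrite mulrA ler_pdivrMr.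
suff : (#|S| <= (Num.truncn l).+1)%N.
  rewrite -(ler_nat R) => /le_trans; apply.
  by rewrite -natr1 lerD2r truncn_le.
rewrite -[leqRHS]card_ord.
pose h (v : 'I_D.+1) : 'I_(Num.truncn l).+1 := inord (v - v0).
have hinj : {in S &, injective h}.
  move=> v w; rewrite !unfold_in => Sv Sw /(congr1 val) /=.
  rewrite !inordK ?ltnS ?Sle// => vw; apply: val_inj => /=.
  by rewrite -(subnK (v0min _ Sv)) vw subnK//; exact: v0min.
by rewrite -(card_in_imset hinj) max_card.
Qed.

Lemma avg_grid_ge (D : nat) (a y rho : R) : 0 < a -> 0 < rho -> rho <= y <= a ->
  4 * a / rho <= D.+1%:R ->
  rho / (2 * a) <= avg (fun v : 'I_D.+1 => (`|a * gridv v - y| <= rho)%R%:R).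
Proof.
move=> a0 rho0 /andP[rhoy ya] Dlarge.
have D0 : 0 < D.+1%:R :> R by rewrite ltr0n.
rewrite /avg card_ord ler_pdivlMr//.
set l : R := rho * D.+1%:R / a.
have l2 : 4 <= l.
  by rewrite /l ler_pdivlMr// -ler_pdivrMl// mulrC.
have -> : rho / (2 * a) * D.+1%:R = l / 2.
  by rewrite /l; field; rewrite gt_eqF.
set A : R := (y - rho) * D.+1%:R / a.
have A0 : 0 <= A by rewrite !mulr_ge0 ?invr_ge0 ?subr_ge0// ltW.
pose n0 := (Num.truncn A).+1; pose k := (Num.truncn l).-1.
have n0A : A < n0%:R <= A + 1.
  rewrite /n0 truncnS_gt/= -natr1 lerD2r truncn_le//.
have kl : k%:R + 1 <= l < k%:R + 2.
  have l0 : (0 < Num.truncn l)%N by rewrite truncn_gt0 (le_trans _ l2)// ler1n.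
  rewrite -natrD natr1 addn2 /k prednK//.
  by rewrite truncn_itv// (le_trans _ l2).
have Al : A + l <= D.+1%:R.
  rewrite /A /l -mulrDl -mulrDl subrK ler_pdivrMr// mulrC.
  by rewrite ler_pM2l.
pose S := [pred v : 'I_D.+1 | `|a * gridv v - y| <= rho].
have -> : \sum_(v < D.+1) (`|a * gridv v - y| <= rho)%R%:R = #|S|%:R :> R.
  exact: (sum_bool_card S).
have itv (i : 'I_k) : A < (n0 + i)%:R < A + l.
  have : (i.+1%:R : R) <= k%:R by rewrite ler_nat.
  have := ler0n R i; clearbody l A n0 k.
  by rewrite natrD -[i.+1%:R]natr1; lra.
have bnd (i : 'I_k) : (n0 + i < D.+1)%N.
  by rewrite -(ltr_nat R); have := itv i; lra.
apply: (@le_trans _ _ k%:R); first lra.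
rewrite ler_nat -[leqLHS]card_ord.
pose h (i : 'I_k) : 'I_D.+1 := Ordinal (bnd i).
have hinj : injective h.
  by move=> i j /(congr1 val)/= /addnI /val_inj.
rewrite -(card_imset _ hinj); apply/subset_leq_card/fintype.subsetP => v.
move=> /imsetP[i _ ->]; rewrite inE /= /gridv /=.
have -> : a * ((n0 + i)%:R / D.+1%:R) - y =
  ((n0 + i)%:R - A - l) * (a / D.+1%:R).
  by rewrite /A /l; field; rewrite !gt_eqF.
have -> : rho = l * (a / D.+1%:R) by rewrite /l; field; rewrite !gt_eqF.
have aD : 0 < a / D.+1%:R by rewrite divr_gt0.
rewrite normrM (gtr0_norm aD) ler_pM2r// ler_norml.
by have := itv i; lra.
Qed.

Section linear_forms.
Context {J : finType} {D : nat}.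
Implicit Types (x : {ffun J -> 'I_D.+1}) (a b : J -> R).

Definition lform a x : R := \sum_j a j * gridv (x j).

Lemma lform_upd a x j v :
  lform a (upd x j v) = a j * gridv v + \sum_(i | i != j) a i * gridv (x i).
Proof.
rewrite /lform (bigD1 j)//= ffunE eqxx; congr +%R; apply: eq_bigr => i ij.
by rewrite ffunE (negbTE ij).
Qed.

Lemma lform_updB a x j v y : lform a (upd x j v) - y =
  a j * gridv v - (y - \sum_(i | i != j) a i * gridv (x i)).
Proof. by rewrite lform_upd opprB addrA. Qed.

Lemma lformB a b x : lform (fun j => a j - b j) x = lform a x - lform b x.
Proof.
by rewrite /lform -sumrB; apply: eq_bigr => j _; rewrite mulrBl.
Qed.

Lemma ler_norm_lform a x : `|lform a x| <= \sum_j `|a j|.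
Proof.
apply: le_trans (ler_norm_sum _ _ _) _; apply: ler_sum => j _.
by have /andP[x0 x1] := gridv_itv (x j); rewrite normrM ler_piMr// ger0_norm.
Qed.

(** A form with a coefficient at least [s] has an approximately bounded
    density, of order [1 / s]. *)
Lemma avg_lform_le a j (s y rho : R) : 0 < s <= `|a j| -> 0 <= rho ->
  avg (fun x => (`|lform a x - y| <= rho)%R%:R) <= 2 * rho / s + D.+1%:R^-1.
Proof.
move=> /andP[s0 sa] rho0; rewrite (avg_upd _ j) ?card_ord//.
rewrite -[leRHS](@avg_cst {ffun J -> 'I_D.+1}); last first.
  by rewrite card_ffun expn_gt0 card_ord.
apply: le_avg => x.
under eq_avg => v do rewrite lform_updB.
have aj0 : a j != 0 by rewrite -normr_gt0 (lt_le_trans s0).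
apply: le_trans (avg_grid_le _ _ _ _) _ => //.
by rewrite lerD2r ler_wpM2l ?mulr_ge0// lef_pV2// posrE// (lt_le_trans s0).
Qed.

(** The second event does not involve the coordinate [j], so the density bound
    for the first one holds conditionally on it. *)
Lemma avg_lform2_le a b j (s y z rho tau : R) : 0 < s <= `|a j| -> b j = 0 ->
  0 <= rho ->
  avg (fun x => (`|lform a x - y| <= rho)%R%:R * (`|lform b x - z| <= tau)%R%:R)
  <= (2 * rho / s + D.+1%:R^-1) * avg (fun x => (`|lform b x - z| <= tau)%R%:R).
Proof.
move=> /andP[s0 sa] bj rho0; rewrite (avg_upd _ j) ?card_ord//.
rewrite -avgZ; apply: le_avg => x.
have bE v : lform b (upd x j v) = lform b x.
  rewrite lform_upd bj mul0r add0r /lform [RHS](bigD1 j)//= bj mul0r.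
  by rewrite add0r.
under eq_avg => v do rewrite lform_updB bE mulrC.
rewrite avgZ mulrC ler_wpM2r//.
have aj0 : a j != 0 by rewrite -normr_gt0 (lt_le_trans s0).
apply: le_trans (avg_grid_le _ _ _ _) _ => //.
by rewrite lerD2r ler_wpM2l ?mulr_ge0// lef_pV2// posrE// (lt_le_trans s0).
Qed.

(** Whatever the other coordinates are, the range of the coordinate [j] covers
    the target. *)
Lemma avg_lform_ge a j (y rho : R) : 0 < a j -> 0 < rho -> 4 * a j / rho <= D.+1%:R ->
  (forall x, rho <= y - \sum_(i | i != j) a i * gridv (x i) <= a j) ->
  rho / (2 * a j) <= avg (fun x => (`|lform a x - y| <= rho)%R%:R).
Proof.
move=> aj rho0 Dl hy; rewrite (avg_upd _ j) ?card_ord//.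
rewrite -[leLHS](@avg_cst {ffun J -> 'I_D.+1}); last first.
  by rewrite card_ffun expn_gt0 card_ord.
apply: le_avg => x.
under eq_avg => v do rewrite lform_updB.
exact: avg_grid_ge.
Qed.

End linear_forms.
End averages.

(** * Lacunary trigonometric sums *)

Section trigonometry.
Context {R : realType}.
Implicit Types x y : R.

Lemma lipschitz1_cos x y : `|cos x - cos y| <= `|x - y|.
Proof.
wlog xy : x y / x <= y => [h|].
  by have [/h//|/ltW/h] := leP x y; rewrite distrC (distrC y).
have cont : {within `[x, y], continuous (@cos R)}.
  by apply: continuous_subspaceT => z; exact: continuous_cos.
have [c _ h] := MVT_segment xy (fun z _ => is_derive_cos z) cont.
by rewrite distrC h normrM normrN (distrC x) ler_piMl//; exact: sin_max.
Qed.

Lemma lipschitz1_sin x y : `|sin x - sin y| <= `|x - y|.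
Proof. by rewrite -!cosBpihalf (le_trans (lipschitz1_cos _ _))// opprB addrA subrK. Qed.

Definition trig (b : bool) (x : R) : R := if b then sin x else cos x.

Lemma trig_max b x : `|trig b x| <= 1.
Proof. by case: b; [exact: sin_max|exact: cos_max]. Qed.

Lemma lipschitz1_trig b x y : `|trig b x - trig b y| <= `|x - y|.
Proof. by case: b; [exact: lipschitz1_sin|exact: lipschitz1_cos]. Qed.

(** The squared distance of two points of the unit circle is
    [2 - 2 * cos (x - y)], which is at least 2 when the angle is not acute; one
    of the two coordinates accounts for half of it. *)
Lemma trig_sep x y : pi / 2 <= `|x - y| <= pi ->
  exists b, 1 <= `|trig b x - trig b y|.
Proof.
move=> /andP[h1 h2].
have cle0 : cos (x - y) <= 0.
  have p0 : 0 < pi :> R := pi_gt0 R.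
  rewrite -cos_norm -cos_pihalf; have := @ltr_cos R `|x - y| (pi / 2).
  by rewrite !in_itv/= (leNgt (cos _)) => ->; rewrite -?leNgt//; lra.
have key : (cos x - cos y) ^+ 2 + (sin x - sin y) ^+ 2 = 2 - 2 * cos (x - y).
  by rewrite cosB; have := cos2Dsin2 x; have := cos2Dsin2 y; lra.
apply: contrapT => /forallNP h.
have lt1 b : (trig b x - trig b y) ^+ 2 < 1.
  have /negP := h b; rewrite -ltNge => h'.
  by rewrite -real_normK ?num_real// expr_lt1.
by have := lt1 true; have := lt1 false; rewrite /trig; lra.
Qed.

End trigonometry.

Section scales.
Context {R : realType}.

(** Scales are cut off at [N]: all distances below [2 ^- N] are treated alike. *)
Lemma dyadic_scale (N : nat) (x : R) : 0 <= x <= 1 ->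
  exists2 m, (m <= N)%N &
    x <= 2 ^- m /\ (m = N \/ 2 ^- m / 2 < x).
Proof.
move=> /andP[x0 x1]; elim: N => [|N [m mN [xm hm]]].
  by exists 0%N => //; split; [rewrite expr0 invr1|left].
have [xN|xN] := leP x (2 ^- N.+1).
  by exists N.+1 => //; split => //; left.
exists m; [exact: leqW|split => //; right].
case: hm => [mE|//]; rewrite mE; move: xN.
by rewrite exprS invfM mulrC.
Qed.

Lemma geom_sum_le (z : R) (N : nat) : 0 <= z < 1 ->
  \sum_(n < N) z ^+ n <= (1 - z)^-1.
Proof.
move=> /andP[z0 z1]; have z1' : 0 < 1 - z by rewrite subr_gt0.
rewrite -[leRHS]div1r ler_pdivlMr// mulrC -opprB mulNr -subrX1.
by rewrite opprB gerBl exprn_ge0.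
Qed.

End scales.

Section lacunary.
Context {R : realType}.
Variables (q L : R) (N : nat).
Hypotheses (q12 : 1 / 2 < q) (q1 : q < 1).

Definition lacJ := option ('I_N.+1 * bool).

(** The coefficient functions of the random sum; the index [None] is that of the
    random shift, whose coefficient does not depend on [u]. *)
Definition lac (u : R) (j : lacJ) : R :=
  if j is Some (n, b) then q ^+ n * trig b (pi * 2 ^+ n * u) else L.

Let q0 : 0 < q. Proof. by move: q12; lra. Qed.

Lemma sum_lacJ (F : lacJ -> R) :
  \sum_j F j = F None + \sum_(n < N.+1) (F (Some (n, false)) + F (Some (n, true))).
Proof.
rewrite (bigD1 None)//=; congr +%R.
rewrite (reindex_omap Some id)/=; last by case.
under eq_bigl do rewrite eqxx.
transitivity (\sum_(n < N.+1) \sum_b F (Some (n, b))).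
  by rewrite pair_bigA/=; apply: eq_bigr => -[n b].
by apply: eq_bigr => n _; rewrite big_bool addrC.
Qed.

Lemma sum_lacJ_Some (F : lacJ -> R) :
  \sum_(j | j != None) F j =
  \sum_(n < N.+1) (F (Some (n, false)) + F (Some (n, true))).
Proof.
apply: (@addrI _ (F None)); rewrite -sum_lacJ [in RHS](bigD1 None)//=.
Qed.

Lemma lac_bound u : \sum_(j | j != None) `|lac u j| <= 2 / (1 - q).
Proof.
rewrite sum_lacJ_Some.
apply: (@le_trans _ _ (2 * \sum_(n < N.+1) q ^+ n)); last first.
  by rewrite ler_wpM2l// geom_sum_le// ltW.
rewrite mulr_sumr; apply: ler_sum => n _.
rewrite !normrM ger0_norm ?exprn_ge0 ?(ltW q0)// -mulrDr mulrC.
rewrite ler_wpM2r ?exprn_ge0 ?(ltW q0)//.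
by rewrite (_ : 2 = 1 + 1)//; apply: lerD; exact: trig_max.
Qed.

Definition osc_cst : R := 8 / (2 * q - 1) + 4 / (1 - q).

Lemma osc_cst_ge1 : 1 <= osc_cst.
Proof.
have q12' := q12; have q1' := q1.
have a0 : 0 <= 8 / (2 * q - 1) by rewrite divr_ge0//; lra.
have : 1 <= 4 / (1 - q) by rewrite ler_pdivlMr; lra.
by rewrite /osc_cst; lra.
Qed.

(** Frequencies below [2 ^ m] are controlled by the Lipschitz bound, the others
    by their amplitude; both contributions are geometric sums. *)
Lemma lac_osc u v m : `|u - v| <= 2 ^- m ->
  \sum_j `|lac u j - lac v j| <= osc_cst * q ^+ m.
Proof.
have q12' := q12; have q1' := q1.
move=> uv; rewrite sum_lacJ /= subrr normr0 add0r.
have m2 : 0 < 2 ^- m :> R by rewrite invr_gt0 exprn_gt0.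
set A := 8 / (2 * q - 1); set B := 4 / (1 - q).
have A0 : 0 <= A by rewrite divr_ge0//; lra.
have B0 : 0 <= B by rewrite divr_ge0//; lra.
pose G n := A * 2 ^- m * (2 * q) ^+ minn n m + B * (q ^+ m - q ^+ maxn n m).
suff le_G : \sum_(n < N.+1) (`|lac u (Some (n, false)) - lac v (Some (n, false))|
    + `|lac u (Some (n, true)) - lac v (Some (n, true))|) <= G N.+1.
  apply: le_trans le_G _; rewrite /osc_cst -/A -/B mulrDl lerD//.
    rewrite -mulrA ler_wpM2l// ler_pdivrMl// ?exprn_gt0// -exprMn.
    by rewrite ler_eXn2l ?geq_minr//; lra.
  by rewrite ler_wpM2l// gerBl exprn_ge0// ltW.
pose t b n : R := `|q ^+ n * trig b (pi * 2 ^+ n * u) - q ^+ n * trig b (pi * 2 ^+ n * v)|.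
rewrite [leLHS](_ : _ = \sum_(n < N.+1) (t false n + t true n))//.
have t1 b n : t b n <= 4 * (2 * q) ^+ n * 2 ^- m.
  rewrite /t -mulrBr normrM ger0_norm ?exprn_ge0 ?(ltW q0)//.
  rewrite (_ : _ * 2 ^- m = q ^+ n * (4 * (2 ^+ n * 2 ^- m))); last first.
    by rewrite exprMn; ring.
  rewrite ler_wpM2l ?exprn_ge0 ?(ltW q0)//.
  rewrite (le_trans (lipschitz1_trig _ _ _))// -mulrBr normrM.
  rewrite ger0_norm ?mulr_ge0 ?pi_ge0 ?exprn_ge0// -mulrA.
  by rewrite ler_pM ?mulr_ge0 ?pi_ge0 ?exprn_ge0 ?ler_wpM2l//; have := pihalf_lt2 R; lra.
have t2 b n : t b n <= 2 * q ^+ n.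
  rewrite /t -mulrBr normrM ger0_norm ?exprn_ge0 ?(ltW q0)// mulrC.
  rewrite ler_wpM2r ?exprn_ge0 ?(ltW q0)// (le_trans (ler_normB _ _))//.
  by rewrite (_ : 2 = 1 + 1)//; apply: lerD; exact: trig_max.
elim: N.+1 => [|n IH].
  by rewrite big_ord0 /G min0n max0n expr0 mulr1 subrr mulr0 addr0 mulr_ge0// ltW.
rewrite big_ord_recr/=; apply: le_trans (lerD IH (lexx _)) _.
have := t1 false n; have := t1 true n; have := t2 false n; have := t2 true n.
rewrite /G; have [nm|mn] := ltnP n m.
  rewrite (minn_idPl nm) (maxn_idPr nm).
  move=> _ _ h1 h2; rewrite exprS.
  have : A * 2 ^- m * (2 * q * (2 * q) ^+ n) =
      A * 2 ^- m * (2 * q) ^+ n + 8 * (2 * q) ^+ n * 2 ^- m.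
    by rewrite /A; field; rewrite expf_neq0//=; apply/eqP; lra.
  lra.
rewrite (minn_idPr (leqW mn)) (maxn_idPl (leqW mn)).
move=> h1 h2 _ _; rewrite exprS.
have : B * (q ^+ m - q * q ^+ n) = B * (q ^+ m - q ^+ n) + 4 * q ^+ n.
  by rewrite /B; field; apply/eqP; lra.
lra.
Qed.

(** At the frequency [2 ^ m] the phases differ by at least a right angle and at
    most a flat one. *)
Lemma lac_sep u v (m : 'I_N.+1) : 2 ^- m / 2 < `|u - v| <= 2 ^- m ->
  exists2 j, j != None & q ^+ m <= `|lac u j - lac v j|.
Proof.
move=> /andP[uv1 uv2].
have m2 : 0 < 2 ^+ m :> R by rewrite exprn_gt0.
have [|b hb] := @trig_sep R (pi * 2 ^+ m * u) (pi * 2 ^+ m * v).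
  rewrite -mulrBr normrM ger0_norm ?mulr_ge0 ?pi_ge0 ?(ltW m2)// -mulrA.
  rewrite ler_wpM2l ?pi_ge0//=; last first.
    by rewrite -ler_pdivrMl// ltW.
  by rewrite -[leRHS]mulr1 ler_wpM2l ?pi_ge0// mulrC -ler_pdivlMr// mul1r.
exists (Some (m, b)) => //=.
by rewrite -mulrBr normrM ger0_norm ?exprn_ge0 ?(ltW q0)// ler_peMr// exprn_ge0// ltW.
Qed.

End lacunary.

(** * Probabilities as real numbers and Gaussian tails *)

Section probability.
Context {R : realType} {disp : measure_display} {T : measurableType disp}.
Variable P : probability T R.

Definition pr (A : set T) : R := fine (P A).

Lemma prE (A : set T) : measurable A -> P A = (pr A)%:E.
Proof. by move=> mA; rewrite /pr fineK// fin_num_measure. Qed.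

Lemma pr_ge0 (A : set T) : 0 <= pr A.
Proof. exact: fine_ge0. Qed.

Lemma pr_le1 (A : set T) : measurable A -> pr A <= 1.
Proof. by move=> mA; rewrite -lee_fin -prE// probability_le1. Qed.

Lemma le_pr (A B : set T) : measurable A -> measurable B -> A `<=` B ->
  pr A <= pr B.
Proof.
by move=> mA mB AB; rewrite -lee_fin -!prE// le_measure ?inE.
Qed.

Lemma prC (A : set T) : measurable A -> pr (~` A) = 1 - pr A.
Proof.
move=> mA; apply: EFin_inj; rewrite -prE; last exact: measurableC.
by rewrite probability_setC// EFinB -prE.
Qed.

Lemma integral_lin_indic (I : finType) (a : I -> R) (A : I -> set T) :
  (forall i, 0 <= a i) -> (forall i, measurable (A i)) ->
  (\int[P]_w (\sum_i a i * \1_(A i) w)%:E = (\sum_i a i * pr (A i))%:E)%E.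
Proof.
move=> a0 mA.
under eq_integral do rewrite -sumEFin.
rewrite ge0_integral_sum//=; first last.
- by move=> i x _; rewrite lee_fin mulr_ge0.
- by move=> i; apply/measurable_EFinP; exact: measurable_funM.
rewrite -sumEFin; apply: eq_bigr => i _.
under eq_integral do rewrite EFinM.
rewrite ge0_integralZl_EFin//=.
  by rewrite integral_indic// setIT EFinM -prE.
by apply/measurable_EFinP; exact: measurable_indic.
Qed.

(** A pointwise inequality between combinations of indicators is an inequality
    between the same combinations of probabilities: all the moment estimates
    below are of this form. *)
Lemma le_lin_indic (I J : finType) (a : I -> R) (b : J -> R)
    (A : I -> set T) (B : J -> set T) :
  (forall i, 0 <= a i) -> (forall j, 0 <= b j) ->
  (forall i, measurable (A i)) -> (forall j, measurable (B j)) ->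
  (forall w, \sum_i a i * \1_(A i) w <= \sum_j b j * \1_(B j) w) ->
  \sum_i a i * pr (A i) <= \sum_j b j * pr (B j).
Proof.
move=> a0 b0 mA mB ab; rewrite -lee_fin -!integral_lin_indic//.
apply: ge0_le_integral => //.
- by move=> w _; rewrite lee_fin sumr_ge0// => i _; rewrite mulr_ge0.
- by apply/measurable_EFinP; apply: measurable_sum => i; exact: measurable_funM.
- by apply/measurable_EFinP; apply: measurable_sum => i; exact: measurable_funM.
- by move=> w _; rewrite lee_fin.
Qed.

Lemma pr_bigcup_le (I : finType) (A : I -> set T) :
  (forall i, measurable (A i)) ->
  pr (\bigcup_i A i) <= \sum_i pr (A i).
Proof.
move=> mA.
have := @le_lin_indic unit I (fun=> 1) (fun=> 1) (fun=> \bigcup_i A i) A.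
rewrite big_const/= card_unit/= mul1r addr0.
under eq_bigr do rewrite mul1r; apply => //.
  by move=> _; apply: fin_bigcup_measurable => //; exact: finite_finset.
move=> w; rewrite big_const card_unit/= mul1r addr0.
under eq_bigr do rewrite mul1r.
rewrite [\1_(\bigcup_i A i) w]indicE.
have [[i iT Aiw]|nA] := pselect ((\bigcup_i A i) w); last first.
  by rewrite memNset//; exact: sumr_ge0.
rewrite mem_set; last by exists i.
by rewrite (bigD1 i)//= indicE mem_set// lerDl sumr_ge0.
Qed.

Lemma chebyshev2 (Y : T -> R) (v a : R) : measurable_fun setT Y ->
  (\int[P]_w (Y w ^+ 2)%:E <= v%:E)%E -> 0 < a ->
  pr [set w | a <= `|Y w|] <= v / a ^+ 2.
Proof.
move=> mY Yv a0.
have mS : measurable [set w | a <= `|Y w|].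
  rewrite -[X in measurable X]setTI; apply: measurable_fun_le => //.
  exact: measurableT_comp.
rewrite ler_pdivlMr ?exprn_gt0// mulrC -lee_fin; apply: le_trans Yv.
have := @integral_lin_indic unit (fun=> a ^+ 2) (fun=> [set w | a <= `|Y w|]).
under eq_integral do rewrite big_const/= card_unit/= addr0.
rewrite big_const/= card_unit/= addr0 => <- //; last by move=> _; exact: exprn_ge0 (ltW a0).
apply: ge0_le_integral => //.
- by move=> w _; rewrite lee_fin mulr_ge0 ?exprn_ge0// ltW.
- by apply/measurable_EFinP; exact: measurable_funM.
- by apply/measurable_EFinP; exact: measurable_funX.
- move=> w _; rewrite lee_fin indicE.
  have [aY|aY] := pselect (a <= `|Y w|); last by rewrite memNset// mulr0 sqr_ge0.
  by rewrite mem_set// mulr1 -[in leRHS]real_normK ?num_real// ler_sqr ?nnegrE ?(ltW a0).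
Qed.

End probability.

Section gaussian_tail.
Context {R : realType}.

(** Comparison with the density of twice the standard deviation spares any
    computation of a tail integral. *)
Lemma normal_pdf_tail (m s v x : R) : s != 0 -> 0 <= v -> v <= `|x - m| ->
  normal_pdf m s x <= 2 * expR (- (v ^+ 2 / (4 * s ^+ 2))) * normal_pdf m (2 * s) x.
Proof.
move=> s0 v0 vx; rewrite !normal_pdfE ?mulf_neq0//.
have s20 : 0 < s ^+ 2 by rewrite exprn_even_gt0.
have -> : normal_peak (2 * s) = normal_peak s / 2.
  rewrite /normal_peak.
  rewrite (_ : (2 * s) ^+ 2 * pi *+ 2 = 2 ^+ 2 * (s ^+ 2 * pi *+ 2)); last by ring.
  rewrite sqrtrM ?exprn_ge0//.
  by rewrite sqrtr_sqr ger0_norm// invfM mulrC.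
rewrite mulrA -mulrA [_ * normal_fun _ _ _]mulrC.
rewrite [leRHS](_ : _ = normal_peak s *
  (normal_fun m (2 * s) x * expR (- (v ^+ 2 / (4 * s ^+ 2))))); last by field.
rewrite ler_wpM2l ?normal_peak_ge0//= /normal_fun -expRD ler_expR.
have : v ^+ 2 <= (x - m) ^+ 2.
  by rewrite -[leRHS]real_normK ?num_real// ler_sqr ?nnegrE.
set X := (x - m) ^+ 2 => vX.
rewrite -subr_ge0.
rewrite (_ : _ - _ = (3 * X - 2 * v ^+ 2) / (8 * s ^+ 2)); last by field.
apply: divr_ge0; last by rewrite mulr_ge0// ltW.
by have := sqr_ge0 v; clearbody X; lra.
Qed.

Lemma normal_tail (m s v : R) : s != 0 -> 0 <= v ->
  (normal_prob m s [set x | (v <= `|x - m|)%R] <=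
   (2 * expR (- (v ^+ 2 / (4 * s ^+ 2))))%:E)%E.
Proof.
move=> s0 v0; rewrite /normal_prob.
set S := [set x | _]; set c := 2 * _.
have c0 : 0 <= c by rewrite mulr_ge0 ?expR_ge0.
have mS : measurable S.
  rewrite -[X in measurable X]setTI; apply: measurable_fun_le => //.
  by apply: measurableT_comp => //; exact: measurable_funB.
apply: (@le_trans _ _ (\int[lebesgue_measure]_(x in S) (c%:E * (normal_pdf m (2 * s) x)%:E))%E).
  apply: ge0_le_integral => //.
  - by move=> x _; rewrite lee_fin normal_pdf_ge0.
  - by apply: measurable_funTS; apply/measurable_EFinP; exact: measurable_normal_pdf.
  - apply: measurable_funTS; apply: measurable_funeM.
    by apply/measurable_EFinP; exact: measurable_normal_pdf.
  - by move=> x Sx; rewrite -EFinM lee_fin normal_pdf_tail.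
rewrite ge0_integralZl_EFin//=; first last.
- by apply: measurable_funTS; apply/measurable_EFinP; exact: measurable_normal_pdf.
- by move=> x _; rewrite lee_fin normal_pdf_ge0.
rewrite -[leRHS]mule1 lee_pmul2l//; last first.
  by rewrite lte_fin mulr_gt0 ?expR_gt0.
rewrite -(integral_normal_pdf m (2 * s)); apply: ge0_subset_integral => //.
  by apply/measurable_EFinP; exact: measurable_normal_pdf.
by move=> x _; rewrite lee_fin normal_pdf_ge0.
Qed.

Lemma normal_prob_itv_le (m s a : R) : s != 0 -> 0 <= a ->
  (normal_prob m s `](- a)%R, a[%classic <= (a / `|s|)%:E)%E.
Proof.
move=> s0 a0; rewrite /normal_prob.
have s1 : 0 < `|s| by rewrite normr_gt0.
apply: (@le_trans _ _ (\int[lebesgue_measure]_(x in `](- a)%R, a[%classic) ((2 * `|s|)^-1)%R%:E)%E).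
  apply: ge0_le_integral => //.
  - by move=> x _; rewrite lee_fin normal_pdf_ge0.
  - by apply: measurable_funTS; apply/measurable_EFinP; exact: measurable_normal_pdf.
  - move=> x _; rewrite lee_fin (le_trans (normal_pdf_ub _ _ s0))//.
    rewrite /normal_peak lef_pV2 ?posrE ?mulr_gt0//; last first.
      by rewrite sqrtr_gt0 pmulrn_lgt0// mulr_gt0 ?pi_gt0// exprn_even_gt0.
    rewrite -[leLHS]ger0_norm ?mulr_ge0// -sqrtr_sqr ler_wsqrtr//.
    rewrite exprMn real_normK ?num_real// -mulrnAr mulrC.
    by rewrite ler_wpM2l ?sqr_ge0//; have := pi_ge2 R; lra.
rewrite integral_cst//=.
rewrite lebesgue_measure_itv/= lte_fin.
case: ifPn => _; last by rewrite mule0 lee_fin divr_ge0.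
by rewrite -EFinB -EFinM lee_fin invfM opprK; lra.
Qed.

Lemma expRN_le_pow (x : R) (n : nat) : (0 < n)%N -> 0 < x ->
  expR (- x) <= (n%:R / x) ^+ n.
Proof.
move=> n0 x0; have n0' : 0 < n%:R :> R by rewrite ltr0n.
rewrite expRN -[leRHS]invrK -exprVn invf_div lef_pV2 ?posrE ?expR_gt0 ?exprn_gt0 ?divr_gt0//.
rewrite -[in leRHS](@divfK _ n%:R _ x) ?gt_eqF// expRM_natr.
rewrite ler_pXn2r ?nnegrE ?expR_ge0 ?divr_ge0 ?ltW//.
by apply: lt_le_trans (expR_ge1Dx _); rewrite ltrDr.
Qed.

(** The first term covers the deviations below 28 times the scale, the second one
    the larger ones, by the power bound [expRN_le_pow] on the exponential. *)
Definition tail_cst (n : nat) : R := 28 ^+ n + 2 * (144 * n%:R) ^+ n.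

Lemma tail_cst_ge0 n : 0 <= tail_cst n.
Proof. by rewrite addr_ge0 ?mulr_ge0 ?exprn_ge0 ?mulr_ge0. Qed.

(** The two parameters of a normal law are controlled by any interval that
    carries three quarters of its mass: the density bound [normal_prob_itv_le]
    gives the standard deviation, and then the concentration around the mean
    gives the mean. *)
Lemma normal_law_tail (disp : measure_display) (T : measurableType disp)
    (P : probability T R) (Y : T -> R) (m s sig u : R) (n : nat) :
  (0 < n)%N -> has_normal_law P Y m s -> 0 < sig -> 0 < u ->
  pr P [set w | 2 * sig <= `|Y w|] <= 4^-1 ->
  pr P [set w | u <= `|Y w|] <= tail_cst n * (sig / u) ^+ n.
Proof.
move=> n0 [mY lawY] sig0 u0 conc.
have mS (c v : R) : measurable [set w | v <= `|Y w - c|].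
  rewrite -[X in measurable X]setTI; apply: measurable_fun_le => //.
  by apply: measurableT_comp => //; exact: measurable_funB.
have mSR (c v : R) : measurable ([set x : R | v <= `|x - c|] : set (measurableTypeR R)).
  rewrite -[X in measurable X]setTI; apply: measurable_fun_le => //.
  by apply: measurableT_comp => //; exact: measurable_funB.
have mS0 (v : R) : measurable [set w | v <= `|Y w|].
  by have := mS 0 v; under eq_set do rewrite subr0.
have su0 : 0 < sig / u by rewrite divr_gt0.
have [u28|u28] := ltP u (28 * sig).
  apply: (le_trans (pr_le1 _ (mS0 u))).
  apply: (@le_trans _ _ (28 ^+ n * (sig / u) ^+ n)); last first.
    by rewrite ler_wpM2r ?exprn_ge0 ?(ltW su0)// /tail_cst lerDl mulr_ge0 ?exprn_ge0 ?mulr_ge0.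
  by rewrite -exprMn exprn_ege1// mulrA ler_pdivlMr// mul1r ltW.
have BE : [set w | `|Y w| < 2 * sig] = ~` [set w | 2 * sig <= `|Y w|].
  by apply/seteqP; split => w /=; rewrite ltNge => /negP.
have mB : measurable [set w | `|Y w| < 2 * sig].
  by rewrite BE; exact: measurableC.
have conc2 : 3 / 4 <= pr P [set w | `|Y w| < 2 * sig].
  by rewrite BE prC//; lra.
have tailm (v : R) : 0 < v -> s != 0 ->
    pr P [set w | v <= `|Y w - m|] <= 2 * expR (- (v ^+ 2 / (4 * s ^+ 2))).
  move=> v0 s0; rewrite -lee_fin -prE//.
  have := lawY _ (mSR m v); rewrite (negbTE s0) => ->.
  by apply: normal_tail => //; exact: ltW.
have small : s != 0 -> `|s| <= 3 * sig.
  move=> s0; have s1 : 0 < `|s| by rewrite normr_gt0.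
  have : ((3 / 4)%:E <= (2 * sig / `|s|)%:E)%E.
    apply: le_trans (normal_prob_itv_le m s0 _); last by rewrite mulr_ge0// ltW.
    have := lawY `]- (2 * sig), (2 * sig)[%classic (measurable_itv _).
    rewrite (negbTE s0) => <-.
    rewrite (_ : Y @^-1` _ = [set w | `|Y w| < 2 * sig]); first by rewrite prE.
    by apply/seteqP; split => w /=; rewrite in_itv/= ltr_norml.
  by rewrite lee_fin ler_pdivlMr//; lra.
have mbound : `|m| <= 14 * sig.
  have [s0|s0] := eqVneq s 0.
    have := lawY `]- (2 * sig), (2 * sig)[%classic (measurable_itv _).
    rewrite s0 eqxx (_ : Y @^-1` _ = [set w | `|Y w| < 2 * sig]); last first.
      by apply/seteqP; split => w /=; rewrite in_itv/= ltr_norml.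
    have [mlt _|mge] := ltP `|m| (2 * sig).
      by rewrite (le_trans (ltW mlt))// ler_wpM2r ?(ltW sig0)//; lra.
    rewrite diracE memNset; last by rewrite /= in_itv/= -ltr_norml ltNge mge.
    by move=> PB; move: conc2; rewrite /pr PB/=; lra.
  have s1 : 0 < `|s| by rewrite normr_gt0.
  have : exists w, `|Y w| < 2 * sig /\ `|Y w - m| < 4 * `|s|.
    apply: contrapT => /forallNP h.
    have sub : [set w | `|Y w| < 2 * sig] `<=` [set w | 4 * `|s| <= `|Y w - m|].
      by move=> w /= Yw; rewrite leNgt; apply/negP => ?; apply: (h w).
    have := le_pr P mB (mS m _) sub.
    have := tailm (4 * `|s|) (mulr_gt0 _ s1) s0.
    rewrite exprMn real_normK ?num_real//.
    rewrite (_ : 4 ^+ 2 * s ^+ 2 / (4 * s ^+ 2) = 4); last by field.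
    have : expR (- 4) <= 5^-1 :> R.
      rewrite expRN lef_pV2 ?posrE ?expR_gt0//.
      by apply: le_trans (expR_ge1Dx _); lra.
    lra.
  move=> [w [h1 h2]]; have := ler_normB (Y w) (Y w - m).
  by rewrite opprB addrC subrK; have := small s0; lra.
have sub : [set w | u <= `|Y w|] `<=` [set w | u / 2 <= `|Y w - m|].
  by move=> w /= uY; have := lerB_dist (Y w) m; lra.
apply: le_trans (le_pr P (mS0 u) (mS m _) sub) _.
have [s0|s0] := eqVneq s 0.
  have := lawY _ (mSR m (u / 2)); rewrite s0 eqxx diracE.
  rewrite memNset/= ?subrr ?normr0; last by apply/negP; rewrite -ltNge divr_gt0.
  rewrite mulr0n /pr => -> /=.
  by rewrite mulr_ge0 ?exprn_ge0 ?(ltW su0)// tail_cst_ge0.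
apply: le_trans (tailm _ _ s0) _; first by rewrite divr_gt0.
have s1 : 0 < `|s| by rewrite normr_gt0.
apply: (@le_trans _ _ (2 * expR (- (u ^+ 2 / (144 * sig ^+ 2))))).
  rewrite ler_wpM2l// ler_expR lerN2.
  have -> : (u / 2) ^+ 2 / (4 * s ^+ 2) = u ^+ 2 / (16 * s ^+ 2) by field.
  have s20 : 0 < s ^+ 2 by rewrite exprn_even_gt0.
  have sig20 : 0 < sig ^+ 2 by rewrite exprn_gt0.
  rewrite ler_wpM2l ?sqr_ge0// lef_pV2 ?posrE ?(mulr_gt0 _ s20) ?(mulr_gt0 _ sig20)//.
  have : s ^+ 2 <= (3 * sig) ^+ 2.
    by rewrite -[leLHS]real_normK ?num_real// ler_sqr ?nnegrE ?small// ?mulr_ge0 ?ltW.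
  by rewrite exprMn; lra.
apply: (@le_trans _ _ (2 * (144 * n%:R) ^+ n * (sig / u) ^+ n)); last first.
  by rewrite ler_wpM2r ?exprn_ge0 ?(ltW su0)// /tail_cst lerDr exprn_ge0.
rewrite -mulrA ler_wpM2l//.
have u0' := ltW u0; have sig0' := ltW sig0.
have uV0 : 0 <= u^-1 by rewrite invr_ge0.
have X0 : 0 < u ^+ 2 / (144 * sig ^+ 2) by rewrite divr_gt0 ?mulr_gt0 ?exprn_gt0.
apply: le_trans (expRN_le_pow n0 X0) _.
rewrite -exprMn ler_pXn2r ?nnegrE ?divr_ge0 ?mulr_ge0 ?(ltW X0) ?(ltW su0)//.
have -> : n%:R / (u ^+ 2 / (144 * sig ^+ 2)) = 144 * n%:R * (sig / u) ^+ 2.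
  by field; rewrite !gt_eqF.
rewrite ler_wpM2l ?mulr_ge0// expr2 ler_piMl ?(ltW su0)//.
by rewrite ler_pdivrMr// mul1r (le_trans _ u28)// ler_peMl ?ltW//; lra.
Qed.

End gaussian_tail.

(** * Increments of fractional Brownian motion *)

Section fbm.
Context {R : realType} {disp : measure_display} {T : measurableType disp}.
Variables (P : probability T R) (H : R) (X : R -> T -> R).
Hypothesis fX : is_fbm1 P H X.
Hypothesis H0 : 0 < H.

Lemma fbm1_measurable (t : R) : 0 <= t -> measurable_fun setT (X t).
Proof.
move=> t0.
have [|m [s [mX _]]] := fbm1_gaussian fX (t := fun _ : 'I_1 => t) (fun=> 1); first by [].
by move: mX; under eq_fun do rewrite big_ord_recl big_ord0 addr0 mul1r.
Qed.

Lemma fbm1_cov_integral (s t : R) : 0 <= s -> 0 <= t ->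
  (\int[P]_w (X s w * X t w)%:E =
   (2^-1 * (`|t| `^ (2 * H) + `|s| `^ (2 * H) - `|t - s| `^ (2 * H)))%:E)%E.
Proof. by move=> s0 t0; rewrite -(fbm1_cov fX)// unlock. Qed.

Lemma fbm1_sqr (t : R) : 0 <= t -> (\int[P]_w (X t w ^+ 2)%:E = (t `^ (2 * H))%:E)%E.
Proof.
move=> t0; under eq_integral do rewrite expr2.
rewrite fbm1_cov_integral// subrr normr0 powR0 ?mulf_neq0 ?gt_eqF//.
by rewrite subr0 ger0_norm//; congr EFin; lra.
Qed.

Lemma fbm1_sqr_integrable (t : R) : 0 <= t ->
  P.-integrable setT (fun w => (X t w ^+ 2)%:E).
Proof.
move=> t0; apply/integrableP; split.
  by apply/measurable_EFinP; apply: measurable_funX; exact: fbm1_measurable.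
under eq_integral do rewrite gee0_abs ?lee_fin ?sqr_ge0//.
by rewrite fbm1_sqr// ltry.
Qed.

Lemma fbm1_mul_integrable (s t : R) : 0 <= s -> 0 <= t ->
  P.-integrable setT (fun w => (X s w * X t w)%:E).
Proof.
move=> s0 t0.
apply: (@le_integrable _ _ _ P setT measurableT _
  (fun w => (X s w ^+ 2)%:E + (X t w ^+ 2)%:E)%E).
- apply/measurable_EFinP; apply: measurable_funM; exact: fbm1_measurable.
- move=> w _; rewrite -EFinD /= lee_fin [leRHS]ger0_norm ?addr_ge0 ?sqr_ge0//.
  rewrite ler_norml; have := sqr_ge0 (X s w - X t w).
  have := sqr_ge0 (X s w + X t w); have := sqr_ge0 (X s w).
  by have := sqr_ge0 (X t w); rewrite !expr2; lra.
- by apply: integrableD => //; exact: fbm1_sqr_integrable.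
Qed.

Lemma fbm1_incr_sqr (s t : R) : 0 <= s -> 0 <= t ->
  (\int[P]_w ((X s w - X t w) ^+ 2)%:E = (`|s - t| `^ (2 * H))%:E)%E.
Proof.
move=> s0 t0.
transitivity (\int[P]_w (((X s w ^+ 2)%:E + (X t w ^+ 2)%:E) -
    (2 : R)%:E * (X s w * X t w)%:E))%E.
  apply: eq_integral => w _.
  rewrite [RHS](_ : _ = (X s w ^+ 2 + X t w ^+ 2 - 2 * (X s w * X t w))%:E)//.
  by congr EFin; ring.
rewrite integralB//; first last.
- by apply: integrableZl => //; exact: fbm1_mul_integrable.
- by apply: integrableD => //; exact: fbm1_sqr_integrable.
rewrite integralD//; try exact: fbm1_sqr_integrable.
rewrite integralZl//; last exact: fbm1_mul_integrable.
rewrite !fbm1_sqr// fbm1_cov_integral//.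
rewrite -[LHS]/(_ + _ - 2 * _)%:E; congr EFin.
by rewrite (distrC t) (ger0_norm s0) (ger0_norm t0); lra.
Qed.

Lemma fbm1_bound (t a : R) : 0 <= t <= 1 -> 0 < a ->
  pr P [set w | a <= `|X t w|] <= (a ^+ 2)^-1.
Proof.
move=> /andP[t0 t1] a0; rewrite -[leRHS]mul1r.
apply: chebyshev2 => //; first exact: fbm1_measurable.
rewrite fbm1_sqr// lee_fin.
apply: (@le_trans _ _ (1 `^ (2 * H))); last by rewrite powR1.
by apply: ge0_ler_powR; rewrite ?nnegrE ?mulr_ge0// ltW.
Qed.

(** The second moment of the increment shows that it is mostly concentrated at
    the scale [sig]; as it is Gaussian, its tail then decays faster than any
    power. *)
Lemma fbm1_incr_tail (s t sig u : R) n : 0 <= s -> 0 <= t -> (0 < n)%N ->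
  0 < sig -> `|s - t| `^ H <= sig -> 0 < u ->
  pr P [set w | u <= `|X s w - X t w|] <= tail_cst n * (sig / u) ^+ n.
Proof.
move=> s0 t0 n0 sig0 stsig u0.
have [|m [sd]] := fbm1_gaussian fX (t := fun k : 'I_2 => if k == 0 then s else t)
    (fun k => if k == 0 then 1 else -1).
  by move=> k; case: ifP.
under eq_fun do rewrite big_ord_recl big_ord1 /= mul1r mulN1r.
move=> law; apply: (normal_law_tail n0 law sig0 u0).
have mY : measurable_fun setT (fun w => X s w - X t w).
  by apply: measurable_funB; exact: fbm1_measurable.
apply: le_trans (chebyshev2 (v := sig ^+ 2) mY _ _) _.
- rewrite fbm1_incr_sqr// lee_fin mulrC powRrM powR_mulrn ?powR_ge0//.
  by rewrite ler_sqr ?nnegrE ?powR_ge0// ltW.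
- by rewrite mulr_gt0.
- by rewrite exprMn invfM mulrA mulrAC divff ?mul1r ?expf_neq0 ?gt_eqF//; lra.
Qed.

End fbm.

(** * The second moment method for a finite random sum *)

Lemma expr_prod_ord (R : pzSemiRingType) (x : R) n : x ^+ n = \prod_(k < n) x.
Proof. by rewrite prodr_const card_ord. Qed.

Section row_norm.
Context {R : realType} {d : nat}.
Implicit Types v : 'rV[R]_d.

Lemma rV_norm_coord v k : `|v 0 k| <= `|v|.
Proof.
by rewrite [leRHS]/Num.norm/= mx_normrE; apply/bigmax_geP; right; exists (0, k).
Qed.

Lemma rV_norm_leP v r : 0 <= r -> (`|v| <= r) <-> forall k, `|v 0 k| <= r.
Proof.
move=> r0; split=> [vr k|vr]; first exact: le_trans (rV_norm_coord v k) vr.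
rewrite [leLHS]/Num.norm/= mx_normrE; apply/bigmax_leP; split => // -[i k] _ /=.
by rewrite ord1.
Qed.

Lemma rV_norm_prod v r : 0 <= r ->
  (`|v| <= r)%R%:R = \prod_k (`|v 0 k| <= r)%R%:R :> R.
Proof.
move=> r0; have [vr|vr] := boolP (`|v| <= r).
  rewrite big1// => k _.
  by have /rV_norm_leP -> := vr.
have [k kr] : exists k, ~~ (`|v 0 k| <= r).
  apply: contrapT => /forallNP h; move/negP: vr; apply; apply/rV_norm_leP => // k.
  by have /negP := h k; rewrite negbK.
by rewrite (bigD1 k)//= (negbTE kr) mul0r.
Qed.

Lemma rV_norm_attained v r : 0 <= r -> r < `|v| -> exists k, `|v| = `|v 0 k|.
Proof.
move=> r0 rv; have : mx_norm v != 0.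
  by rewrite -[mx_norm v]/(`|v|) gt_eqF// (le_lt_trans r0).
by move=> /mx_norm_neq0[[i k]] /= vE; exists k; rewrite -(ord1 i).
Qed.

Lemma measurable_rV_ball (disp : measure_display) (T : measurableType disp)
    (Y : T -> 'rV[R]_d) (v : 'rV[R]_d) (r : R) :
  (forall k, measurable_fun setT (fun w => Y w 0 k)) -> 0 <= r ->
  measurable [set w | `|Y w - v| <= r].
Proof.
move=> mY r0.
rewrite (_ : [set w | _] = \bigcap_(k in [set: 'I_d]) [set w | `|Y w 0 k - v 0 k| <= r]).
  apply: fin_bigcap_measurable => // k _.
  rewrite -[X in measurable X]setTI; apply: measurable_fun_le => //.
  by apply: measurableT_comp => //; apply: measurable_funB.
apply/seteqP; split => w /=.
  by move=> /(rV_norm_leP _ r0) h k _; have := h k; rewrite !mxE.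
by move=> h; apply/(rV_norm_leP _ r0) => k; have := h k I; rewrite !mxE.
Qed.

End row_norm.

Section one_coordinate.
Context {R : realType}.
Variables (q L : R) (N D : nat).
Hypotheses (q12 : 1 / 2 < q) (q1 : q < 1).
Notation eta := (q ^+ N).
Notation osc := (@osc_cst R q).

Lemma avg_lac_ge u (y : R) : 0 < L -> 4 * L / eta <= D.+1%:R ->
  eta + 2 / (1 - q) <= y <= L - 2 / (1 - q) ->
  eta / (2 * L) <= avg (fun x : {ffun lacJ N -> 'I_D.+1} =>
    (`|lform (lac q L u) x - y| <= eta)%R%:R).
Proof.
move=> L0 DL /andP[y1 y2]; have q0 : 0 < q by move: q12; lra.
have eta0 : 0 < eta by rewrite exprn_gt0.
apply: (avg_lform_ge (j := None)) => // x.
have : `|\sum_(j | j != None) lac q L u j * gridv (x j)| <= 2 / (1 - q).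
  apply: le_trans (lac_bound L N q12 q1 u).
  apply: le_trans (ler_norm_sum _ _ _) _; apply: ler_sum => j _.
  by have /andP[x0 x1] := @gridv_itv R _ (x j); rewrite normrM ler_piMr// ger0_norm.
by rewrite ler_norml /=; lra.
Qed.

(** The constant term of the sum makes the first constraint cost [eta]; the
    second one, on the increment, costs [eta / q ^+ m] since some coefficient of
    the increment has size [q ^+ m], and is void beyond the oscillation. *)
Lemma avg_lac2_le u v (y z : R) (m : 'I_N.+1) : 1 <= L -> eta^-1 <= D.+1%:R ->
  `|u - v| <= 2 ^- m -> (m = N :> nat \/ 2 ^- m / 2 < `|u - v|) ->
  avg (fun x : {ffun lacJ N -> 'I_D.+1} =>
    (`|lform (lac q L u) x - y| <= eta)%R%:R *
    (`|lform (lac q L v) x - z| <= eta)%R%:R) <=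
  15 * eta ^+ 2 / q ^+ m * (`|y - z| <= (osc + 2) * q ^+ m)%R%:R.
Proof.
move=> L1 De uv hm; have q0 : 0 < q by move: q12; lra.
have eta0 : 0 < eta by rewrite exprn_gt0.
have qm0 : 0 < q ^+ m by rewrite exprn_gt0.
have D0 : 0 < D.+1%:R :> R by rewrite ltr0n.
have De' : D.+1%:R^-1 <= eta by rewrite invf_ple ?posrE.
have etaqm : eta <= q ^+ m.
  by apply: ler_wiXn2l; rewrite ?(ltW q0) ?(ltW q1)// -ltnS.
have cardT : (0 < #|{ffun lacJ N -> 'I_D.+1}|)%N.
  by rewrite card_ffun expn_gt0 card_ord.
set a := lac q L u; set b := fun j => a j - lac q L v j.
have -> : 15 * eta ^+ 2 / q ^+ m = (3 * eta) * (5 * eta / q ^+ m).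
  by field; rewrite gt_eqF.
apply: (@le_trans _ _ (avg (fun x : {ffun lacJ N -> 'I_D.+1} =>
    (`|lform a x - y| <= eta)%R%:R *
    (`|lform b x - (y - z)| <= 2 * eta)%R%:R))).
  apply: le_avg => x; rewrite lformB.
  case: (leP `|lform a x - y|) => h1; last by rewrite !mul0r.
  case: (leP `|lform (lac q L v) x - z|) => h2; last by rewrite mulr0 mul1r.
  rewrite !mul1r (_ : `|_| <= _)//.
  have -> : lform a x - lform (lac q L v) x - (y - z) =
    (lform a x - y) - (lform (lac q L v) x - z) by ring.
  by rewrite (le_trans (ler_normB _ _))// mulr_natl mulr2n lerD.
have aN : 0 < L <= `|a None|.
  by rewrite /a /= ger0_norm ?lexx ?andbT; lra.
have bN : b None = 0 by rewrite /b /a /= subrr.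
apply: le_trans (@avg_lform2_le R _ D a b None L y (y - z) eta _ aN bN (ltW eta0)) _.
have L0 : 0 < L by lra.
rewrite -[leRHS]mulrA ler_pM//.
- by rewrite addr_ge0 ?invr_ge0// divr_ge0 ?mulr_ge0 ?(ltW eta0) ?(ltW L0).
- by apply: avg_ge0.
- suff h : 2 * eta / L <= 2 * eta by rewrite (le_trans (lerD h De'))//; lra.
  by rewrite ler_piMr ?mulr_ge0 ?(ltW eta0)// invf_le1//; lra.
have [yz|yz] := leP `|y - z|; last first.
  rewrite mulr0 /avg big1 ?mul0r// => x _.
  rewrite leNgt (_ : _ < _)//.
  have h1 : `|lform b x| <= osc * q ^+ m.
    by apply: le_trans (ler_norm_lform _ _) _; exact: lac_osc.
  rewrite distrC; apply: lt_le_trans (_ : `|y - z| - `|lform b x| <= _).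
    by move: yz; rewrite mulrDl; lra.
  by rewrite lerB_dist.
rewrite mulr1; have [mN|mN] := eqVneq (m : nat) N.
  apply: (@le_trans _ _ (avg (fun _ : {ffun lacJ N -> 'I_D.+1} => 1))).
    by apply: le_avg => x; rewrite lern1 leq_b1.
  by rewrite avg_cst// mN -mulrA divff ?gt_eqF// mulr1; lra.
case: hm => [/eqP|hm]; first by rewrite (negbTE mN).
have [|j jN hj] := lac_sep L q12 (u := u) (v := v) (m := m); first by rewrite hm.
have bj : 0 < q ^+ m <= `|b j| by rewrite qm0.
have e2 : 0 <= 2 * eta by rewrite mulr_ge0// ltW.
apply: le_trans (@avg_lform_le R _ D b j _ (y - z) _ bj e2) _.
suff h : eta <= eta / q ^+ m.
  rewrite (le_trans (lerD (lexx _) (le_trans De' h)))//.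
  by rewrite -(mulrA 5) (mulrA 2 2) -mulrA; lra.
by rewrite ler_peMr ?(ltW eta0)// invf_ge1// exprn_ile1 ?ltW.
Qed.

End one_coordinate.

Section second_moment.
Context {R : realType} {d : nat}.
Variables (q L : R) (N D : nat).
Hypotheses (q12 : 1 / 2 < q) (q1 : q < 1).
Notation eta := (q ^+ N).
Notation osc := (@osc_cst R q).
Notation coefs := {ffun 'I_d -> {ffun lacJ N -> 'I_D.+1}}.

Definition lacf (V : coefs) (u : R) : 'rV[R]_d :=
  \row_k lform (lac q L u) (V k).

Lemma avg_lacf_ge u (y : 'rV[R]_d) : 0 < L -> 4 * L / eta <= D.+1%:R ->
  (forall k, eta + 2 / (1 - q) <= y 0 k <= L - 2 / (1 - q)) ->
  (eta / (2 * L)) ^+ d <= avg (fun V => (`|lacf V u - y| <= eta)%R%:R).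
Proof.
move=> L0 DL hy; have q0 : 0 < q by move: q12; lra.
have eta0 : 0 <= eta by rewrite exprn_ge0// ltW.
rewrite (eq_avg (G := fun V : coefs => \prod_k
    (`|lform (lac q L u) (V k) - y 0 k| <= eta)%R%:R)); last first.
  by move=> V; rewrite rV_norm_prod//; apply: eq_bigr => k _; rewrite !mxE.
rewrite (avg_prod (fun k x => (`|lform (lac q L u) x - y 0 k| <= eta)%R%:R)).
rewrite expr_prod_ord.
apply: ler_prod => k _; rewrite divr_ge0 ?mulr_ge0 ?(ltW L0)//=.
exact: avg_lac_ge.
Qed.

Lemma avg_lacf2_le u v (y z : 'rV[R]_d) (m : 'I_N.+1) : 1 <= L ->
  eta^-1 <= D.+1%:R ->
  `|u - v| <= 2 ^- m -> (m = N :> nat \/ 2 ^- m / 2 < `|u - v|) ->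
  avg (fun V => (`|lacf V u - y| <= eta)%R%:R * (`|lacf V v - z| <= eta)%R%:R) <=
  (15 * eta ^+ 2 / q ^+ m) ^+ d * (`|y - z| <= (osc + 2) * q ^+ m)%R%:R.
Proof.
move=> L1 De uv hm; have q0 : 0 < q by move: q12; lra.
have eta0 : 0 <= eta by rewrite exprn_ge0// ltW.
have o1 := osc_cst_ge1 q12 q1.
rewrite (eq_avg (G := fun V : coefs => \prod_k
    ((`|lform (lac q L u) (V k) - y 0 k| <= eta)%R%:R *
     (`|lform (lac q L v) (V k) - z 0 k| <= eta)%R%:R))); last first.
  move=> V; rewrite !rV_norm_prod// -big_split.
  by apply: eq_bigr => k _; rewrite !mxE.
rewrite (avg_prod (fun k x => (`|lform (lac q L u) x - y 0 k| <= eta)%R%:R *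
     (`|lform (lac q L v) x - z 0 k| <= eta)%R%:R)).
rewrite rV_norm_prod; last by rewrite mulr_ge0 ?exprn_ge0 ?(ltW q0)//; lra.
rewrite [(15 * _ / _) ^+ _]expr_prod_ord -big_split.
apply: ler_prod => k _; rewrite avg_ge0/=; last by move=> x; rewrite mulr_ge0.
by rewrite !mxE; exact: avg_lac2_le.
Qed.

End second_moment.

Lemma indic_bool (R : pzRingType) (T : Type) (b : T -> bool) (o : T) :
  \1_[set o | b o] o = (b o)%:R :> R.
Proof.
rewrite indicE; have [bo|/negP bo] := boolP (b o); first by rewrite mem_set.
by rewrite memNset.
Qed.

Section hitting.
Context {R : realType} {d : nat}.
Variables (q L : R) (N D : nat).
Hypotheses (q12 : 1 / 2 < q) (q1 : q < 1).
Notation eta := (q ^+ N).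
Notation osc := (@osc_cst R q).
Notation coefs := {ffun 'I_d -> {ffun lacJ N -> 'I_D.+1}}.
Context {I J : finType}.
Variables (u w : I -> R) (x : J -> 'rV[R]_d) (mu : J -> R) (c : 'rV[R]_d).
Variables (ms : I -> I -> 'I_N.+1).
Hypotheses (w0 : forall i, 0 <= w i) (mu0 : forall j, 0 <= mu j).
Hypothesis mu1 : \sum_j mu j = 1.
Hypothesis ms_le : forall i i', `|u i - u i'| <= 2 ^- ms i i'.
Hypothesis ms_max : forall i i',
  ms i i' = N :> nat \/ 2 ^- ms i i' / 2 < `|u i - u i'|.
Hypothesis L1 : 1 <= L.
Hypothesis DL : 4 * L / eta <= D.+1%:R.

(** Encounter, up to [eta], of [lacf + b + c] with one of the points [x]. *)
Definition hits (b : I -> 'rV[R]_d) (V : coefs) :=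
  [exists p : I * J, `|lacf q L V (u p.1) - (x p.2 - (b p.1 + c))| <= eta].

(** The Paley--Zygmund argument, in the linear form [2 Z <= lam Z^2 + 1_A / lam]
    where [Z], the weighted number of encounters, vanishes outside [A]. *)
Lemma second_moment_pointwise (b : I -> 'rV[R]_d) (bb lam : R) : 0 < lam ->
  (forall i j k, `|b i| <= bb ->
     eta + 2 / (1 - q) <= (x j - (b i + c)) 0 k <= L - 2 / (1 - q)) ->
  2 * (eta / (2 * L)) ^+ d * (\sum_i w i * (`|b i| <= bb)%R%:R) <=
  lam * (\sum_p \sum_p' (w p.1 * mu p.2) * (w p'.1 * mu p'.2) *
    (15 * eta ^+ 2 / q ^+ ms p.1 p'.1) ^+ d *
    (`|b p.1 - b p'.1 - (x p.2 - x p'.2)| <= (osc + 2) * q ^+ ms p.1 p'.1)%R%:R)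
  + lam^-1 * avg (fun V => (hits b V)%:R).
Proof.
move=> lam0 hb; have q0 : 0 < q by move: q12; lra.
have L0 : 0 < L by move: L1; lra.
have eta0 : 0 < eta by rewrite exprn_gt0.
pose X (p : I * J) (V : coefs) : R :=
  (`|lacf q L V (u p.1) - (x p.2 - (b p.1 + c))| <= eta)%R%:R.
pose om (p : I * J) := w p.1 * mu p.2.
have om0 p : 0 <= om p by rewrite mulr_ge0.
pose Z V := \sum_p om p * X p V.
have pw V : 2 * Z V <= lam * Z V ^+ 2 + lam^-1 * (hits b V)%:R.
  have [hV|hV] := boolP (hits b V).
    rewrite mulr1 -subr_ge0.
    rewrite (_ : _ - _ = lam * (Z V - lam^-1) ^+ 2); last by field; rewrite gt_eqF.
    by rewrite mulr_ge0 ?sqr_ge0// ltW.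
  have -> : Z V = 0.
    rewrite /Z big1// => p _; rewrite /X; case: leP; rewrite ?mulr0// => Vp.
    by move/negP: hV => []; apply/existsP; exists p.
  by rewrite !mulr0 expr0n/= mulr0 addr0.
have := le_avg pw; rewrite avgZ => avpw.
have low : (eta / (2 * L)) ^+ d * (\sum_i w i * (`|b i| <= bb)%R%:R) <= avg Z.
  rewrite /Z avg_sum mulr_sumr.
  under [leRHS]eq_bigr do rewrite avgZ.
  rewrite -(pair_bigA _ (fun i j => om (i, j) * avg (X (i, j))))/=.
  apply: ler_sum => i _.
  rewrite [leLHS](_ : _ = \sum_j om (i, j) *
      ((eta / (2 * L)) ^+ d * (`|b i| <= bb)%R%:R)); last first.
    by rewrite -mulr_suml /om /= -mulr_sumr mu1; ring.
  apply: ler_sum => j _; apply: ler_wpM2l => //.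
  have [bi|bi] := boolP (`|b i| <= bb); last by rewrite mulr0 avg_ge0.
  by rewrite mulr1; apply: avg_lacf_ge => // k; exact: hb.
have upp : avg (fun V => Z V ^+ 2) <= \sum_p \sum_p' om p * om p' *
    (15 * eta ^+ 2 / q ^+ ms p.1 p'.1) ^+ d *
    (`|b p.1 - b p'.1 - (x p.2 - x p'.2)| <= (osc + 2) * q ^+ ms p.1 p'.1)%R%:R.
  rewrite (eq_avg (G := fun V => \sum_p \sum_p' om p * om p' * (X p V * X p' V))); last first.
    move=> V; rewrite expr2 /Z mulr_suml; apply: eq_bigr => p _.
    by rewrite mulr_sumr; apply: eq_bigr => p' _; ring.
  rewrite avg_sum; apply: ler_sum => p _.
  rewrite avg_sum; apply: ler_sum => p' _.
  rewrite avgZ -[leRHS]mulrA ler_wpM2l ?mulr_ge0//.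
  have De : eta^-1 <= D.+1%:R.
    apply: le_trans DL; rewrite -[leLHS]mul1r ler_wpM2r ?invr_ge0 ?(ltW eta0)//.
    by move: L1; lra.
  have := avg_lacf2_le q12 q1 (x p.2 - (b p.1 + c)) (x p'.2 - (b p'.1 + c))
    L1 De (ms_le p.1 p'.1) (ms_max p.1 p'.1).
  rewrite (_ : x p.2 - (b p.1 + c) - (x p'.2 - (b p'.1 + c)) =
     - (b p.1 - b p'.1 - (x p.2 - x p'.2))); first by rewrite normrN.
  by apply/rowP => k; rewrite !mxE; ring.
rewrite -mulrA (le_trans (ler_wpM2l _ low))// (le_trans avpw)//.
rewrite /avg; under eq_bigr do [].
rewrite big_split/= -!mulr_sumr mulrDl -!mulrA lerD2r ler_wpM2l ?(ltW lam0)//.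
Qed.

Lemma measurable_hits (disp : measure_display) (T : measurableType disp)
    (B : I -> T -> 'rV[R]_d) (V : coefs) :
  (forall i k, measurable_fun setT (fun o => B i o 0 k)) ->
  measurable [set o | hits (fun i => B i o) V].
Proof.
move=> mB; have q0 : 0 < q by move: q12; lra.
rewrite (_ : [set o | _] = \bigcup_(p in [set: I * J])
    [set o | `|B p.1 o - (x p.2 - lacf q L V (u p.1) - c)| <= eta]).
  apply: fin_bigcup_measurable => // p _.
  by apply: measurable_rV_ball => //; rewrite exprn_ge0// ltW.
have E o p : `|lacf q L V (u p.1) - (x p.2 - (B p.1 o + c))| =
    `|B p.1 o - (x p.2 - lacf q L V (u p.1) - c)|.
  by congr (`|_|); apply/rowP => k; rewrite !mxE; ring.
apply/seteqP; split => o /=.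
  by move=> /existsP[p]; rewrite E; exists p.
by move=> [p _ /= h]; apply/existsP; exists p; rewrite E.
Qed.

(** The pairs whose scale is [m] are among those at distance at most [2 ^- m]. *)
Lemma sum_scales_le (F : 'I_N.+1 -> R) (i : I) : (forall m, 0 <= F m) ->
  \sum_i' w i' * F (ms i i') <=
  \sum_m F m * (\sum_i' w i' * (`|u i - u i'| <= 2 ^- m)%R%:R).
Proof.
move=> F0; under [leRHS]eq_bigr do rewrite mulr_sumr.
rewrite exchange_big/=; apply: ler_sum => i' _.
rewrite (bigD1 (ms i i'))//= ms_le mulr1 mulrC lerDl.
by apply: sumr_ge0 => m _; rewrite !mulr_ge0.
Qed.

(** The second moment bound. The time measure gives mass of order [kappa ^+ m] to
    balls of radius [2 ^- m], the increments of [B] are close to those of [x] at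
    scale [m] with probability of order [theta ^+ m * G], and the random function
    contributes [q ^- (m * d)]; the sum over the scales is geometric, with ratio
    [kappa * theta / q ^+ d]. Some choice of the coefficients does at least as
    well as the average. *)
Lemma hitting_lower_bound (disp : measure_display) (T : measurableType disp)
    (P : probability T R) (B : I -> T -> 'rV[R]_d)
    (G : J -> J -> R) (bb theta kappa near mass En : R) :
  0 <= bb -> \sum_i w i = 1 ->
  (forall i k, measurable_fun setT (fun o => B i o 0 k)) ->
  (forall i, 2^-1 <= pr P [set o | `|B i o| <= bb]) ->
  (forall i j k o, `|B i o| <= bb ->
     eta + 2 / (1 - q) <= (x j - (B i o + c)) 0 k <= L - 2 / (1 - q)) ->
  0 <= theta -> 0 <= kappa -> kappa * theta / q ^+ d < 1 ->
  0 < near -> 0 < mass -> 0 < En ->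
  (forall j j', 0 <= G j j') ->
  \sum_j \sum_j' mu j * mu j' * G j j' <= En ->
  (forall i i' j j' (m : 'I_N.+1), `|u i - u i'| <= 2 ^- m ->
     pr P [set o | `|B i o - B i' o - (x j - x j')| <= (osc + 2) * q ^+ m]
       <= near * theta ^+ m * G j j') ->
  (forall i (m : 'I_N.+1),
     \sum_i' w i' * (`|u i - u i'| <= 2 ^- m)%R%:R <= mass * kappa ^+ m) ->
  exists V : coefs,
    ((2 * L) ^- d) ^+ 2 / (4 * (15 ^+ d * near * mass *
       (1 - kappa * theta / q ^+ d)^-1)) / En <=
    pr P [set o | hits (fun i => B i o) V].
Proof.
move=> bb0 w1 mB hbb hbox th0 ka0 rho1 near0 mass0 En0 G0 GE hpr hmass.
have q0 : 0 < q by move: q12; lra.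
have L0 : 0 < L by move: L1; lra.
have eta0 : 0 < eta by rewrite exprn_gt0.
have osc0 : 0 <= osc + 2 by have := osc_cst_ge1 q12 q1; lra.
set rho := kappa * theta / q ^+ d in rho1 *.
have rho0 : 0 <= rho by rewrite !mulr_ge0 ?invr_ge0 ?exprn_ge0 ?(ltW q0).
pose a0 : R := (eta / (2 * L)) ^+ d.
have a00 : 0 < a0 by rewrite exprn_gt0// divr_gt0// mulr_gt0.
pose C := 15 ^+ d * near * mass * (1 - rho)^-1.
have C0 : 0 < C by rewrite !mulr_gt0 ?exprn_gt0// invr_gt0 subr_gt0.
pose K (i i' : I) : R := (15 * eta ^+ 2 / q ^+ ms i i') ^+ d.
have K0 i i' : 0 <= K i i'.
  by rewrite exprn_ge0// divr_ge0 ?mulr_ge0 ?exprn_ge0 ?(ltW q0)// ?(ltW eta0).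
pose NB (p p' : I * J) := [set o | `|B p.1 o - B p'.1 o - (x p.2 - x p'.2)| <=
    (osc + 2) * q ^+ ms p.1 p'.1].
have mNB p p' : measurable (NB p p').
  apply: measurable_rV_ball; last by rewrite mulr_ge0 ?exprn_ge0 ?(ltW q0).
  move=> k; rewrite (_ : (fun _ => _) = (fun o => B p.1 o 0 k - B p'.1 o 0 k)).
    exact: measurable_funB.
  by apply/funext => o; rewrite !mxE.
have mbb i : measurable [set o | `|B i o| <= bb].
  under eq_set do rewrite -(subr0 (B i _)).
  exact: measurable_rV_ball.
pose S := \sum_p \sum_p' (w p.1 * mu p.2) * (w p'.1 * mu p'.2) *
    K p.1 p'.1 * pr P (NB p p').
have S_le : S <= C * (eta ^+ 2) ^+ d * En.
  have : forall p p', (w p.1 * mu p.2) * (w p'.1 * mu p'.2) * K p.1 p'.1 *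
      pr P (NB p p') <= (15 ^+ d * near * (eta ^+ 2) ^+ d) *
      ((w p.1 * (w p'.1 * (theta / q ^+ d) ^+ ms p.1 p'.1)) *
       (mu p.2 * mu p'.2 * G p.2 p'.2)).
    move=> p p'; have := hpr p.1 p'.1 p.2 p'.2 (ms p.1 p'.1) (ms_le _ _).
    move=> /(ler_wpM2l _) h; apply: le_trans (h _ _) _; first by rewrite !mulr_ge0.
    rewrite le_eqVlt; apply/orP; left; apply/eqP.
    have KE (e : R) m : (15 * e / q ^+ m) ^+ d * theta ^+ m =
        15 ^+ d * e ^+ d * (theta / q ^+ d) ^+ m.
      by rewrite !expr_div_n exprMn -!exprM (mulnC d); ring.
    transitivity (w p.1 * mu p.2 * (w p'.1 * mu p'.2) * near * G p.2 p'.2 *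
      (K p.1 p'.1 * theta ^+ ms p.1 p'.1)); first by ring.
    by rewrite /K KE; ring.
  move=> le1; apply: (@le_trans _ _ (\sum_p \sum_p' (15 ^+ d * near * (eta ^+ 2) ^+ d) *
      ((w p.1 * (w p'.1 * (theta / q ^+ d) ^+ ms p.1 p'.1)) *
       (mu p.2 * mu p'.2 * G p.2 p'.2)))).
    by apply: ler_sum => p _; apply: ler_sum => p' _; exact: le1.
  under eq_bigr do rewrite -mulr_sumr.
  rewrite -mulr_sumr.
  have -> : \sum_(p : I * J) \sum_(p' : I * J)
      ((w p.1 * (w p'.1 * (theta / q ^+ d) ^+ ms p.1 p'.1)) *
       (mu p.2 * mu p'.2 * G p.2 p'.2)) =
    (\sum_i w i * \sum_i' w i' * (theta / q ^+ d) ^+ ms i i') *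
    (\sum_j \sum_j' mu j * mu j' * G j j').
    rewrite -(pair_bigA _ (fun i j => \sum_(p' : I * J)
      ((w i * (w p'.1 * (theta / q ^+ d) ^+ ms i p'.1)) *
       (mu j * mu p'.2 * G j p'.2))))/=.
    rewrite mulr_suml; apply: eq_bigr => i _.
    rewrite mulr_sumr; apply: eq_bigr => j _.
    rewrite -(pair_bigA _ (fun i' j' =>
      ((w i * (w i' * (theta / q ^+ d) ^+ ms i i')) *
       (mu j * mu j' * G j j'))))/=.
    rewrite [w i * _]mulr_sumr mulr_suml; apply: eq_bigr => i' _.
    by rewrite mulr_sumr.
  have th : forall i, \sum_i' w i' * (theta / q ^+ d) ^+ ms i i' <= mass * (1 - rho)^-1.
    move=> i; have := @sum_scales_le (fun m => (theta / q ^+ d) ^+ m) i.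
    move=> /(_ _) h; apply: le_trans (h _) _.
      by move=> m; rewrite exprn_ge0// divr_ge0 ?exprn_ge0 ?(ltW q0).
    apply: (@le_trans _ _ (\sum_(m < N.+1) mass * rho ^+ m)).
      apply: ler_sum => m _.
      have := hmass i m => /(ler_wpM2l _) h1; apply: le_trans (h1 _ _) _.
        by rewrite exprn_ge0// divr_ge0 ?exprn_ge0 ?(ltW q0).
      by rewrite mulrCA -exprMn (mulrC (theta / _)) mulrA.
    by rewrite -mulr_sumr ler_wpM2l ?(ltW mass0)// geom_sum_le// rho0.
  have sI : \sum_i w i * \sum_i' w i' * (theta / q ^+ d) ^+ ms i i' <= mass * (1 - rho)^-1.
    apply: (@le_trans _ _ (\sum_i w i * (mass * (1 - rho)^-1))).
      by apply: ler_sum => i _; rewrite ler_wpM2l.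
    by rewrite -mulr_suml w1 mul1r.
  rewrite /C (_ : _ * En = 15 ^+ d * near * (eta ^+ 2) ^+ d * ((mass * (1 - rho)^-1) * En)); last by ring.
  apply: ler_wpM2l; first by rewrite !mulr_ge0 ?exprn_ge0 ?(ltW near0)// ltW.
  apply: ler_pM => //.
    rewrite sumr_ge0// => i _; rewrite mulr_ge0// sumr_ge0// => i' _.
    by rewrite mulr_ge0// exprn_ge0// divr_ge0 ?exprn_ge0 ?(ltW q0).
  by rewrite sumr_ge0// => j _; rewrite sumr_ge0// => j' _; rewrite !mulr_ge0.
pose Sb := C * (eta ^+ 2) ^+ d * En.
have Sb0 : 0 < Sb.
  by rewrite mulr_gt0// mulr_gt0// exprn_gt0// exprn_gt0.
(* the choice of [lam] for which the quadratic term is at most half of the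
   linear one *)
pose lam := a0 / (2 * Sb).
have lam0 : 0 < lam by rewrite divr_gt0// mulr_gt0.
have cardV : (0 < #|{: coefs}|)%N by rewrite card_ffun expn_gt0 card_ffun expn_gt0 card_ord.
have avgP : 2 * a0 * \sum_i w i * pr P [set o | `|B i o| <= bb] <=
    lam * S + lam^-1 * avg (fun V => pr P [set o | hits (fun i => B i o) V]).
  pose bc (s : ((I * J) * (I * J)) + {: coefs}) : R := match s with
    | inl pp => lam * ((w pp.1.1 * mu pp.1.2) * (w pp.2.1 * mu pp.2.2) * K pp.1.1 pp.2.1)
    | inr V => lam^-1 / #|{: coefs}|%:R end.
  pose bs (s : ((I * J) * (I * J)) + {: coefs}) : set T := match s with
    | inl pp => NB pp.1 pp.2
    | inr V => [set o | hits (fun i => B i o) V] end.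
  have := @le_lin_indic R disp T P I _ (fun i => 2 * a0 * w i) bc
    (fun i => [set o | `|B i o| <= bb]) bs.
  rewrite !big_sumType/= => /(_ _ _ _ _ _) h.
  rewrite mulr_sumr; under eq_bigr do rewrite mulrA.
  apply: le_trans (h _ _ _ _ _) _.
  - by move=> i; rewrite !mulr_ge0// ltW.
  - case=> [pp|V] /=; first by rewrite mulr_ge0 ?(ltW lam0)// !mulr_ge0.
    by rewrite mulr_ge0 ?invr_ge0// ltW.
  - exact: mbb.
  - by case=> [pp|V] /=; [exact: mNB|exact: measurable_hits].
  - move=> o; rewrite big_sumType/=.
    have := second_moment_pointwise (b := fun i => B i o) (bb := bb) lam0 (fun i j k => hbox i j k o).
    congr (_ <= _).
    + rewrite mulr_sumr; apply: eq_bigr => i _; rewrite mulrA; congr (_ * _).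
      by rewrite indic_bool.
    + congr (_ + _).
        rewrite mulr_sumr -(pair_bigA _ (fun p p' => lam * ((w p.1 * mu p.2) *
          (w p'.1 * mu p'.2) * K p.1 p'.1) * \1_(NB p p') o))/=.
        apply: eq_bigr => p _; rewrite mulr_sumr; apply: eq_bigr => p' _.
        rewrite !mulrA; congr (_ * _).
        by rewrite /NB indic_bool.
      rewrite /avg mulr_suml mulr_sumr; apply: eq_bigr => V _.
      rewrite mulrCA mulrC; congr (_ * _).
      by rewrite indic_bool.
  - apply: lerD.
      rewrite /S mulr_sumr -(pair_bigA _ (fun p p' => lam * ((w p.1 * mu p.2) *
        (w p'.1 * mu p'.2) * K p.1 p'.1) * pr P (NB p p')))/=.
      apply: ler_sum => p _; rewrite mulr_sumr; apply: ler_sum => p' _.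
      by rewrite !mulrA.
    rewrite /avg mulr_suml mulr_sumr; apply: ler_sum => V _.
    by rewrite mulrCA mulrC.
have half : 2^-1 <= \sum_i w i * pr P [set o | `|B i o| <= bb].
  rewrite [leLHS](_ : _ = \sum_i w i * 2^-1); last by rewrite -mulr_suml w1 mul1r.
  apply: ler_sum => i _.
  by rewrite ler_wpM2l.
have avg_ge : a0 ^+ 2 / (4 * Sb) <=
    avg (fun V => pr P [set o | hits (fun i => B i o) V]).
  have h1 : a0 <= 2 * a0 * \sum_i w i * pr P [set o | `|B i o| <= bb].
    by have := ler_wpM2l (ltW a00) half; lra.
  have h2 : lam * S <= a0 / 2.
    apply: le_trans (ler_wpM2l (ltW lam0) S_le) _.
    by rewrite -/Sb /lam le_eqVlt; apply/orP; left; apply/eqP; field; rewrite gt_eqF.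
  have h3 : a0 / 2 <= lam^-1 * avg (fun V => pr P [set o | hits (fun i => B i o) V]).
    by move: avgP h1 h2; lra.
  move: h3; rewrite ler_pdivlMl//; apply: le_trans; rewrite /lam le_eqVlt; apply/orP; left; apply/eqP.
  by field; rewrite gt_eqF.
have [V hV] := avg_le_ex cardV avg_ge.
exists V; apply: le_trans hV.
rewrite le_eqVlt; apply/orP; left; apply/eqP.
have e0 : eta ^+ d != 0 by rewrite expf_neq0// gt_eqF.
have aE : a0 = eta ^+ d * (2 * L) ^- d by rewrite /a0 expr_div_n.
have eE : (eta ^+ 2) ^+ d = (eta ^+ d) ^+ 2 by rewrite exprAC.
rewrite -/C /Sb aE eE; clearbody C; move: ((2 * L) ^- d) (eta ^+ d) e0 => A e e0.
by field; rewrite e0 !gt_eqF.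
Qed.

End hitting.

(** * Discretisation of measures on compact sets *)

(** Interiors of balls are used because they are open, hence measurable. *)
Lemma finite_net (R : realType) (T : normedModType R) (A : set T) (h : R) :
  compact A -> 0 < h ->
  exists n (c : 'I_n -> T), (forall i, A (c i)) /\
    A `<=` \bigcup_i (ball (c i) h)^°.
Proof.
rewrite compact_cover => cA h0.
have [||D DA AD] := cA T A (fun x => (ball x h)^°).
- by move=> x _; exact: open_interior.
- by move=> x Ax; exists x => //; exact: nbhsx_ballx.
pose s := in_tuple (finmap.enum_fset D).
exists (size (finmap.enum_fset D)), (tnth s); split => [i|x Ax].
  by apply/set_mem/DA; rewrite mem_tnth.
have [y /= yD xy] := AD _ Ax.
have /tnthP[i yi] : y \in s by [].
by exists i => //; rewrite -yi.
Qed.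

Section cells.
Context {T : Type} {n : nat}.
Variable U : 'I_n -> set T.

Definition cell (i : 'I_n) := U i `\` \bigcup_(j in [set j : 'I_n | (j < i)%N]) U j.

Lemma cell_sub i : cell i `<=` U i.
Proof. by move=> x []. Qed.

Lemma cell_inj x i j : cell i x -> cell j x -> i = j.
Proof.
move=> [Ui Ni] [Uj Nj]; apply/val_inj => /=.
case: (ltngtP i j) => // ij; first by exfalso; apply: Nj; exists i.
by exfalso; apply: Ni; exists j.
Qed.

Lemma cell_cover x i : U i x -> exists j, cell j x.
Proof.
move=> Ui; pose p := [pred k : 'I_n | `[< U k x >]].
have pi : p i by apply/asboolP.
case: (arg_minnP (val : 'I_n -> nat) pi) => j /asboolP Uj jmin.
exists j; split => // -[k /= kj Uk].
by have := jmin k; rewrite leqNgt kj => /(_ (asboolT Uk)).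
Qed.

End cells.

Lemma measurable_cell (disp : measure_display) (T : measurableType disp) n
  (U : 'I_n -> set T) i : (forall i, measurable (U i)) -> measurable (cell U i).
Proof.
by move=> mU; apply: measurableD => //; apply: fin_bigcup_measurable.
Qed.

Section weights.
Context {R : realType} {disp : measure_display} {T : measurableType disp}.
Variables (P : probability T R) (n : nat) (U : 'I_n -> set T) (A : set T).
Hypotheses (mU : forall i, measurable (U i)) (mA : measurable A).
Hypotheses (PA : P A = 1%E) (AU : A `<=` \bigcup_i U i).

Lemma sum_cell_le (S : pred 'I_n) (B : set T) : measurable B ->
  (forall i, S i -> U i `<=` B) ->
  \sum_i pr P (cell U i) * (S i)%:R <= pr P B.
Proof.
move=> mB SB.
have mC i := measurable_cell i mU.
have := @le_lin_indic _ _ _ P _ unit (fun i => (S i)%:R) (fun=> 1) (cell U) (fun=> B).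
rewrite big_const card_unit/= mul1r addr0.
under eq_bigr do rewrite mulrC.
apply => // x; rewrite big_const card_unit/= mul1r addr0.
have [[i Six]|noS] := pselect (exists i, S i /\ cell U i x).
  have [Si Cix] := Six.
  rewrite (bigD1 i)//= big1 ?addr0 => [|j ji].
    rewrite [in leRHS]indicE mem_set; last exact: SB Si _ (cell_sub Cix).
    by rewrite Si mul1r indicE lern1 leq_b1.
  rewrite indicE memNset ?mulr0// => Cjx; move/eqP: ji; apply.
  exact: cell_inj Cjx Cix.
rewrite big1// => i _; have [Si|] := boolP (S i); last by rewrite mul0r.
by rewrite indicE memNset ?mulr0// => Cix; apply: noS; exists i.
Qed.

Lemma sum_cell1 : \sum_i pr P (cell U i) = 1.
Proof.
have mC i := measurable_cell i mU.
apply/eqP; rewrite eq_le; apply/andP; split.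
  have := @sum_cell_le predT setT measurableT (fun _ _ => @subsetT _ _).
  under eq_bigr do rewrite mulr1.
  by rewrite /(pr P setT) probability_setT.
have : pr P A <= \sum_i pr P (cell U i).
  have := @le_lin_indic _ _ _ P unit _ (fun=> 1) (fun=> 1) (fun=> A) (cell U).
  rewrite big_const card_unit/= mul1r addr0.
  under eq_bigr do rewrite mul1r.
  apply => // x; rewrite big_const card_unit/= mul1r addr0.
  under eq_bigr do rewrite mul1r.
  rewrite [leLHS]indicE; have [Ax|Ax] := pselect (A x); last first.
    by rewrite memNset// sumr_ge0.
  have [i _ Uix] := AU Ax; have [j Cjx] := cell_cover Uix.
  rewrite mem_set// (bigD1 j)//= indicE mem_set// lerDl sumr_ge0//.
by rewrite /pr PA.
Qed.

End weights.

Section energy.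
Context {R : realType} {disp : measure_display} {T : measurableType disp}.
Variable P : probability T R.

(** The integral of a nonnegative function is a supremum over simple functions,
    so that monotonicity holds for arbitrary functions; this avoids the
    measurability of the inner integral of an energy. *)
Lemma ge0_le_integralT (f g : T -> \bar R) :
  (forall x, 0 <= f x)%E -> (forall x, f x <= g x)%E ->
  (\int[P]_x f x <= \int[P]_x g x)%E.
Proof.
move=> f0 fg; rewrite !ge0_integralTE//; last by move=> x; exact: le_trans (f0 x) (fg x).
apply: ge_ereal_sup => _ [h /= hf <-]; apply: ereal_sup_ubound.
by exists h => //= x; exact: le_trans (hf x) (fg x).
Qed.

Lemma sum_cells_energy_le (n : nat) (C : 'I_n -> set T) (G : 'I_n -> 'I_n -> R)
    (k : T -> T -> \bar R) :
  (forall i, measurable (C i)) -> (forall x i j, C i x -> C j x -> i = j) ->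
  (forall i j, 0 <= G i j) -> (forall x y, 0 <= k x y)%E ->
  (forall i j x y, C i x -> C j y -> (G i j)%:E <= k x y)%E ->
  ((\sum_i \sum_j pr P (C i) * pr P (C j) * G i j)%:E <=
   \int[P]_x \int[P]_y k x y)%E.
Proof.
move=> mC Cinj G0 k0 Gk.
pose a x j : R := \sum_i G i j * \1_(C i) x.
have a0 x j : 0 <= a x j by apply: sumr_ge0 => i _; rewrite mulr_ge0.
have -> : \sum_i \sum_j pr P (C i) * pr P (C j) * G i j =
    \sum_i (\sum_j G i j * pr P (C j)) * pr P (C i).
  by apply: eq_bigr => i _; rewrite mulr_suml; apply: eq_bigr => j _; ring.
rewrite -integral_lin_indic//; last first.
  by move=> i; apply: sumr_ge0 => j _; rewrite mulr_ge0// pr_ge0.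
apply: ge0_le_integralT => x.
  rewrite lee_fin; apply: sumr_ge0 => i _; rewrite mulr_ge0// sumr_ge0// => j _.
  by rewrite mulr_ge0// pr_ge0.
have -> : \sum_i (\sum_j G i j * pr P (C j)) * \1_(C i) x = \sum_j a x j * pr P (C j).
  rewrite /a; under [RHS]eq_bigr do rewrite mulr_suml.
  rewrite [RHS]exchange_big; apply: eq_bigr => i _; rewrite mulr_suml.
  by apply: eq_bigr => j _; ring.
rewrite -integral_lin_indic//; apply: ge0_le_integralT => y.
  by rewrite lee_fin; apply: sumr_ge0 => j _; rewrite mulr_ge0.
have [[i Cix]|nx] := pselect (exists i, C i x); last first.
  rewrite big1 ?k0// => j _; rewrite /a big1 ?mul0r// => i _.
  by rewrite indicE memNset ?mulr0// => Cix; apply: nx; exists i.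
have [[j Cjy]|ny] := pselect (exists j, C j y); last first.
  rewrite big1 ?k0// => j _.
  by rewrite indicE memNset ?mulr0// => Cjy; apply: ny; exists j.
rewrite (bigD1 j)//= [X in _ + X]big1 ?addr0; last first.
  move=> j' j'j; rewrite indicE memNset ?mulr0// => Cj'y.
  by move/eqP: j'j; apply; exact: Cinj Cj'y Cjy.
rewrite indicE mem_set// mulr1 /a (bigD1 i)//= big1 ?addr0; last first.
  move=> i' i'i; rewrite indicE memNset ?mulr0// => Ci'x.
  by move/eqP: i'i; apply; exact: Cinj Ci'x Cix.
by rewrite indicE mem_set// mulr1; exact: Gk.
Qed.

End energy.

Section localisation.
Context {R : realType}.
Implicit Types (E : set R) (beta : R).

(** Choosing the ball on which the ratio [nu (ball a r) / r ^ beta] is nearly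
    maximal, and rescaling, gives an upper regularity constant which does not
    depend on the one of [nu]. *)
Lemma beta_regular_localize E beta : 0 < beta -> compact E ->
  beta_regular beta E ->
  exists (Q : probability (measurableTypeR R) R) (a r : R),
    [/\ 0 < r <= 1, Q (E `&` `[a - r, a + r]) = 1%E &
      forall x del : R, E x -> 0 < del ->
        pr Q `[x - del, x + del] <= 2 * (del / r) `^ beta].
Proof.
move=> beta0 cE [nu [c [c0 nu0 nuE reg]]].
have mE : measurable E.
  by apply: closed_measurable; apply: compact_closed => //; exact: Rhausdorff.
have fin (A : set (measurableTypeR R)) : measurable A -> nu A = (fine (nu A))%:E.
  by move=> mA; rewrite fineK// fin_num_measure.
have mball (x del : R) : measurable (`[x - del, x + del]%classic : set (measurableTypeR R)).
  exact: measurable_itv.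
have nuC0 : nu (~` E) = 0%E by apply/negligibleP => //; exact: measurableC.
have [a0 Ea0] : exists a, E a.
  apply: contrapT => /forallNP nE; move: nu0.
  rewrite (_ : setT = ~` E) ?nuC0 ?ltxx//.
  by apply/seteqP; split => // x _; exact: nE.
pose ratio (a del : R) : R := fine (nu `[a - del, a + del]%classic) / del `^ beta.
pose S := [set v | exists a del, [/\ E a, 0 < del <= 1 & v = ratio a del]].
have ratio_itv a del : E a -> 0 < del <= 1 -> c^-1 <= ratio a del <= c.
  move=> Ea del01; have /andP[d0 _] := del01.
  have /andP[] := reg _ _ Ea del01; rewrite fin// !lee_fin => h1 h2.
  by rewrite /ratio ler_pdivlMr ?powR_gt0// ler_pdivrMr ?powR_gt0// h1.
have S0 : S !=set0.
  by exists (ratio a0 1), a0, 1; split => //; rewrite ltr01 lexx.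
have Sub : has_ubound S.
  by exists c => _ [a [del [Ea del01 ->]]]; have /andP[] := ratio_itv _ _ Ea del01.
have sup0 : 0 < sup S.
  apply: (@lt_le_trans _ _ (ratio a0 1)).
    apply: (@lt_le_trans _ _ c^-1); first by rewrite invr_gt0.
    by have /andP[] := @ratio_itv a0 1 Ea0 ltac:(by rewrite ltr01 lexx).
  by apply: ub_le_sup => //; exists a0, 1; rewrite ltr01 lexx.
have [v [a [r [Ea r01 ->]]] hr] : exists2 v, S v & sup S / 2 < v.
  by apply: sup_gt => //; lra.
have /andP[r0 r1] := r01.
set z := fine (nu `[a - r, a + r]%classic).
have rb0 : 0 < r `^ beta by rewrite powR_gt0.
have zge : sup S / 2 * r `^ beta < z by move: hr; rewrite /ratio ltr_pdivlMr.
have z0 : 0 < z by apply: le_lt_trans zge; rewrite mulr_ge0 ?divr_ge0 ?ltW.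
pose Q : probability (measurableTypeR R) R :=
  mnormalize (mrestr nu (mball a r)) (\d_(a : measurableTypeR R)).
have QE (A : set (measurableTypeR R)) : measurable A ->
    Q A = (fine (nu (A `&` `[a - r, a + r])) / z)%:E.
  move=> mA; rewrite /Q /= /mnormalize /= /mrestr setTI.
  rewrite [nu `[_, _]%classic]fin// -/z ifF; last by rewrite eqe (gt_eqF z0).
  by rewrite fin; [rewrite EFinM|exact: measurableI].
exists Q, a, r; split => //.
  have mI : measurable (E `&` `[a - r, a + r] : set (measurableTypeR R)).
    exact: measurableI.
  rewrite QE// -setIA setIid.
  rewrite (_ : nu (E `&` _) = nu `[a - r, a + r]%classic).
    by rewrite -/z divff// gt_eqF.
  have DE0 : nu (`[a - r, a + r]%classic `\` E) = 0%E.
    apply/eqP; rewrite -measure_le0 -nuC0; apply: le_measure; rewrite ?inE.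
    - exact: measurableD.
    - exact: measurableC.
    - by move=> x [].
  rewrite setIC; transitivity (0 + nu (`[(a - r)%R, (a + r)%R]%classic `&` E))%E.
    by rewrite add0e.
  by rewrite -DE0; apply/esym; exact: measureDI.
move=> x del Ex del0.
have [del1|del1] := leP del 1; last first.
  apply: le_trans (pr_le1 _ _) _ => //.
  have : 1 <= (del / r) `^ beta.
    apply: (@le_trans _ _ (1 `^ beta)); first by rewrite powR1.
    apply: ge0_ler_powR; rewrite ?nnegrE ?(ltW beta0) ?divr_ge0 ?(ltW r0) ?(ltW del0)//.
    by rewrite ler_pdivlMr// mul1r (le_trans r1)// ltW.
  lra.
rewrite /pr QE//= ler_pdivrMr//.
apply: (@le_trans _ _ (sup S * del `^ beta)).
  rewrite -ler_pdivrMr ?powR_gt0//.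
  apply: (@le_trans _ _ (ratio x del)).
    rewrite /ratio ler_wpM2r ?invr_ge0 ?powR_ge0//.
    rewrite -lee_fin -!fin//; last exact: measurableI.
    by apply: le_measure; rewrite ?inE//; exact: measurableI.
  by apply: ub_le_sup => //; exists x, del; split => //; rewrite del0.
have -> : del `^ beta = (del / r) `^ beta * r `^ beta.
  by rewrite -powRM ?divr_ge0 ?(ltW r0) ?(ltW del0)// divfK// gt_eqF.
rewrite mulrCA [leRHS]mulrAC [leRHS]mulrC ler_wpM2l ?powR_ge0//.
by move: zge; lra.
Qed.

End localisation.

Section nets.
Context {R : realType}.

(** The cells have radius at most [2 * r * 2 ^- m]; those whose centre lies in a
    ball of this radius lie in the ball of twice the radius. *)
Lemma time_net (Q : probability (measurableTypeR R) R) (E : set R)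
    (a r beta : R) (N : nat) :
  0 < beta <= 1 -> compact E -> 0 < r ->
  Q (E `&` `[a - r, a + r]) = 1%E ->
  (forall x del : R, E x -> 0 < del ->
     pr Q `[x - del, x + del] <= 2 * (del / r) `^ beta) ->
  exists n (t w : 'I_n -> R),
    [/\ forall i, E (t i) /\ `|t i - a| <= r,
        forall i, 0 <= w i, \sum_i w i = 1 &
        forall i (m : 'I_N.+1),
          \sum_i' w i' * (`|t i - t i'| <= 2 * r * 2 ^- m)%R%:R <=
          8 * (2 `^ (- beta)) ^+ m].
Proof.
move=> /andP[beta0 beta1] cE r0 QA reg.
set A := E `&` _ in QA.
have cA : compact A.
  by apply: compact_closedI => //; exact: interval_closed.
have mA : measurable (A : set (measurableTypeR R)).
  by apply: closed_measurable; apply: compact_closed => //; exact: Rhausdorff.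
pose h := 2 * r * 2 ^- N.
have h0 : 0 < h by rewrite !mulr_gt0// invr_gt0 exprn_gt0.
have [n [t [tA Acov]]] := finite_net cA h0.
pose U (i : 'I_n) : set (measurableTypeR R) := (ball (t i) h)^°.
have mU i : measurable (U i) by apply: open_measurable; exact: open_interior.
exists n, t, (fun i => pr Q (cell U i)); split.
- move=> i; have [Eti] := tA i; rewrite /= in_itv/= => ati; split => //.
  by rewrite ler_norml; move: ati; lra.
- by move=> i; exact: pr_ge0.
- exact: (sum_cell1 mU mA QA).
move=> i m.
have m2 : 2 ^- N <= 2 ^- m :> R.
  rewrite lef_pV2 ?posrE ?exprn_gt0// ler_eXn2l ?ltr1n// -ltnS //.
pose del := 4 * r * 2 ^- m.
have m0 : 0 < 2 ^- m :> R by rewrite invr_gt0 exprn_gt0.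
have del0 : 0 < del by rewrite !mulr_gt0.
have mB : measurable (`[t i - del, t i + del]%classic : set (measurableTypeR R)).
  exact: measurable_itv.
apply: le_trans (@sum_cell_le R _ _ Q n U mU
  (fun i' => `|t i - t i'| <= 2 * r * 2 ^- m) _ mB _) _.
  move=> i' tii' x /interior_subset; rewrite /ball/= => xt.
  rewrite in_itv/= -ler_distl.
  have hle : h <= 2 * r * 2 ^- m by rewrite /h ler_wpM2l// mulr_ge0// ltW.
  apply: le_trans (ler_distD (t i') _ _) _.
  rewrite addrC (distrC (t i')) (distrC x).
  apply: le_trans (lerD tii' (le_trans (ltW xt) hle)) _.
  by rewrite /del; lra.
have [Eti _] := tA i.
apply: le_trans (reg _ _ Eti del0) _.
have -> : del / r = 4 * 2 ^- m by rewrite /del mulrAC mulfK ?gt_eqF.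
rewrite powRM ?(ltW m0)//.
have -> : (2 ^- m) `^ beta = (2 `^ (- beta)) ^+ m :> R.
  rewrite -powR_mulrn ?powR_ge0// -powRrM mulNr mulrC -mulNr powRrM.
  by rewrite powR_invn.
have : 4 `^ beta <= 4 :> R.
  rewrite -[leRHS]powRr1//; apply: ler_powR => //; lra.
move=> h4; rewrite mulrA ler_wpM2r ?exprn_ge0 ?powR_ge0//; lra.
Qed.

Lemma enorm_le (d : nat) (v : 'rV[R]_d) : enorm v <= d%:R * `|v|.
Proof.
rewrite /enorm -[leRHS]ger0_norm ?mulr_ge0// -sqrtr_sqr ler_wsqrtr// exprMn.
apply: (@le_trans _ _ (\sum_(i < d) `|v| ^+ 2)).
  apply: ler_sum => i _; rewrite -[leLHS]real_normK ?num_real//.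
  by rewrite ler_sqr ?nnegrE// rV_norm_coord.
rewrite sumr_const card_ord -[leLHS]mulr_natl ler_wpM2r ?sqr_ge0//.
by rewrite expr2 -natrM ler_nat; case: d {v} => // d; rewrite leq_pmulr.
Qed.

Lemma riesz_kernel_ge1 (gamma r : R) : gamma <= 0 -> 0 <= r ->
  (1 <= riesz_kernel gamma r)%E.
Proof.
move=> g0 r0; rewrite /riesz_kernel; case: ifPn => // gN.
case: ifPn => [_|rN0]; first by rewrite leey.
have r0' : 0 < r by rewrite lt_neqAle eq_sym rN0.
rewrite ifT; last by rewrite eq_le g0 leNgt.
rewrite lee_fin -[leLHS]expRK ler_ln ?posrE ?expR_gt0//; last first.
  by rewrite divr_gt0 ?expR_gt0// lt_min r0' ltr01.
rewrite ler_pdivlMr ?lt_min ?r0' ?ltr01// ler_piMr ?expR_ge0//.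
by rewrite ge_min lexx orbT.
Qed.

(** For [gamma <= 0] both sides are compared with 1. *)
Lemma riesz_kernel_ge (gamma r s : R) (D : nat) : gamma <= D%:R -> 0 <= r ->
  0 < s -> r <= 3 * D%:R * s -> (0 < D)%N ->
  (((3 * D%:R) ^- D * s `^ (- Num.max gamma 0))%:E <= riesz_kernel gamma r)%E.
Proof.
move=> gD r0 s0 rs D0.
have D0' : 1 <= D%:R :> R by rewrite ler1n.
have DD : 0 < D%:R :> R by lra.
have D3 : 1 <= 3 * D%:R :> R by lra.
have D30 : 0 < 3 * D%:R :> R by lra.
have [g0|g0] := leP gamma 0.
  rewrite oppr0 powRr0 mulr1; apply: le_trans (riesz_kernel_ge1 g0 r0).
  by rewrite lee_fin invf_le1 ?exprn_gt0// exprn_ege1.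
rewrite /riesz_kernel ltNge (ltW g0)/=.
case: ifPn => [_|rN0]; first by rewrite leey.
have r0' : 0 < r by rewrite lt_neqAle eq_sym rN0.
rewrite gt_eqF// lee_fin.
apply: (@le_trans _ _ ((3 * D%:R * s) `^ (- gamma))).
  rewrite powRM ?(ltW D30) ?(ltW s0)// ler_wpM2r ?powR_ge0// powRN.
  rewrite lef_pV2 ?posrE ?powR_gt0 ?exprn_gt0// -powR_mulrn ?(ltW D30)//.
  by apply: ler_powR.
rewrite !powRN lef_pV2 ?posrE ?powR_gt0 ?mulr_gt0//.
by apply: ge0_ler_powR; rewrite ?nnegrE ?(ltW g0) ?(ltW r0) ?mulr_ge0 ?(ltW s0).
Qed.

Lemma enorm_ge0 (d : nat) (v : 'rV[R]_d) : 0 <= enorm v.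
Proof. exact: sqrtr_ge0. Qed.

Lemma measurable_borelRd (d : nat) (A : set 'rV[R]_d) : open A ->
  measurable (A : set (borelRd R d)).
Proof. by move=> oA; exact: sub_sigma_algebra. Qed.

(** The kernel at distance [Num.max `|x j - x j'| h] is smaller, up to a constant,
    than the kernel at any two points of the cells of [x j] and [x j']; on the
    diagonal the net cannot resolve distances below [h]. *)
Lemma space_net (d : nat) (mu : probability (borelRd R d) R)
    (F : set 'rV[R]_d) (gamma h : R) :
  (0 < d)%N -> compact F -> mu.-negligible (~` F) -> gamma <= d%:R -> 0 < h ->
  exists n (x : 'I_n -> 'rV[R]_d) (w : 'I_n -> R),
    [/\ forall j, F (x j), forall j, 0 <= w j, \sum_j w j = 1 &
      (((3 * d%:R) ^- d * \sum_j \sum_j' w j * w j' *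
         (Num.max `|x j - x j'| h) `^ (- Num.max gamma 0))%:E <=
       riesz_energy gamma mu)%E].
Proof.
move=> d0 cF muF gd h0.
have mF : measurable (F : set (borelRd R d)).
  rewrite -[F]setCK; apply: measurableC; apply: measurable_borelRd.
  by apply: closed_openC; apply: compact_closed => //; exact: norm_hausdorff.
have muF1 : mu F = 1%E.
  have muC0 : mu (~` F) = 0%E by apply/negligibleP => //; exact: measurableC.
  by rewrite prE//; have := prC mu mF; rewrite {1}/pr muC0/= => h1; congr EFin; lra.
have [n [x [xF Fcov]]] := finite_net cF h0.
pose U (i : 'I_n) : set (borelRd R d) := (ball (x i) h)^°.
have mU i : measurable (U i) by apply: measurable_borelRd; exact: open_interior.
have mC i := measurable_cell i mU.
have near_center i (z : 'rV[R]_d) : cell U i z -> `|x i - z| < h.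
  move=> Ciz; have := interior_subset (cell_sub Ciz).
  by rewrite -ball_normE.
exists n, x, (fun i => pr mu (cell U i)); split => //.
- by move=> i; exact: pr_ge0.
- exact: (sum_cell1 mU mF muF1).
rewrite mulr_sumr.
under eq_bigr do rewrite mulr_sumr.
under eq_bigr do under eq_bigr do rewrite mulrCA.
rewrite /riesz_energy; apply: sum_cells_energy_le => //.
- exact: cell_inj.
- by move=> i j; rewrite mulr_ge0 ?powR_ge0// invr_ge0 exprn_ge0// mulr_ge0.
- move=> p y; apply: le_trans (riesz_kernel_ge (s := enorm (p - y) + 1) gd _ _ _ d0).
  + by rewrite lee_fin mulr_ge0 ?powR_ge0// invr_ge0 exprn_ge0// mulr_ge0.
  + exact: enorm_ge0.
  + by rewrite ltr_wpDl// enorm_ge0.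
  + have d1 : 1 <= d%:R :> R by rewrite ler1n.
    have e0 := enorm_ge0 (p - y).
    apply: (@le_trans _ _ (enorm (p - y) + 1)); first by rewrite lerDl.
    by rewrite ler_peMl//; lra.
- move=> i j p y /near_center xp /near_center xy.
  apply: riesz_kernel_ge => //; first exact: enorm_ge0.
    by rewrite lt_max h0 orbT.
  apply: le_trans (enorm_le _) _.
  rewrite mulrAC [leRHS]mulrC ler_wpM2l//.
  have : `|p - y| <= h + `|x i - x j| + h.
    have E (a b c e : 'rV[R]_d) : a - e = (a - b) + (b - c) + (c - e).
      by rewrite (addrA (a - b)) subrK (addrA (a - c)) subrK.
    rewrite (E p (x i) (x j) y) (le_trans (ler_normD _ _))// lerD// ?(ltW xy)//.
    by rewrite (le_trans (ler_normD _ _))// lerD// distrC ltW.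
  have m1 : `|x i - x j| <= Num.max `|x i - x j| h by rewrite le_max lexx.
  have m2 : h <= Num.max `|x i - x j| h by rewrite le_max lexx orbT.
  by move: m1 m2; move: (Num.max _ _) => M; lra.
Qed.

End nets.

(** * Encounters at a given scale and the constants *)

Section fbm_vector.
Context {R : realType} {disp : measure_display} {T : measurableType disp}.
Variables (P : probability T R) (d : nat) (H : R) (B : R -> T -> 'rV[R]_d).
Hypotheses (d0 : (0 < d)%N) (fB : is_fbm P H B) (H0 : 0 < H).

Lemma fbm_measurable_coord (t : R) k : 0 <= t ->
  measurable_fun setT (fun o => B t o 0 k).
Proof. by move=> t0; exact: fbm1_measurable (fbm_components fB k) _ t0. Qed.

Lemma fbm_box (t : R) : 0 <= t <= 1 -> 2^-1 <= pr P [set o | `|B t o| <= 2 * d%:R].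
Proof.
move=> t01; have /andP[t0 t1] := t01.
have D0 : 0 < d%:R :> R by rewrite ltr0n.
have D1 : 1 <= d%:R :> R by rewrite ler1n.
have m1 : measurable [set o | `|B t o| <= 2 * d%:R].
  under eq_set do rewrite -(subr0 (B t _)).
  by apply: measurable_rV_ball; [move=> k; exact: fbm_measurable_coord|rewrite mulr_ge0].
pose A (k : 'I_d) := [set o | 2 * d%:R <= `|B t o 0 k|].
have mA k : measurable (A k).
  rewrite -[X in measurable X]setTI; apply: measurable_fun_le => //.
  by apply: measurableT_comp => //; exact: fbm_measurable_coord.
have : pr P (~` [set o | `|B t o| <= 2 * d%:R]) <= pr P (\bigcup_k A k).
  apply: le_pr; first exact: measurableC.
    by apply: fin_bigcup_measurable => // k _; exact: mA.
  move=> o /= /negP; rewrite -ltNge => lt.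
  have [|k Bk] := rV_norm_attained _ lt; first by rewrite mulr_ge0.
  by exists k => //; rewrite /A /= -Bk ltW.
rewrite prC// => le1.
have le2 := pr_bigcup_le P mA.
have le3 : \sum_k pr P (A k) <= \sum_(k < d) ((2 * d%:R) ^+ 2)^-1.
  apply: ler_sum => k _.
  by apply: (fbm1_bound (fbm_components fB k) H0 t01); rewrite mulr_gt0.
have le4 : \sum_(k < d) ((2 * d%:R) ^+ 2)^-1 <= 4^-1 :> R.
  rewrite sumr_const card_ord -[leLHS]mulr_natl.
  rewrite (_ : _ * _ = (4 * d%:R)^-1); last by field; rewrite gt_eqF.
  by rewrite lef_pV2 ?posrE ?mulr_gt0//; lra.
lra.
Qed.

(** The largest coordinate of [z] must be approached by that of the increment. *)
Lemma fbm_incr_near (s t sig rho : R) (z : 'rV[R]_d) : 0 <= s -> 0 <= t ->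
  0 < sig -> `|s - t| `^ H <= sig -> 0 <= rho -> 2 * rho < `|z| ->
  pr P [set o | `|B s o - B t o - z| <= rho] <=
    tail_cst d * (2 * sig / `|z|) ^+ d.
Proof.
move=> s0 t0 sig0 stsig rho0 zrho.
have [|k zk] := rV_norm_attained _ zrho; first by rewrite mulr_ge0.
have z0 : 0 < `|z| by apply: le_lt_trans zrho; rewrite mulr_ge0.
have mI j : measurable_fun setT (fun o => (B s o - B t o) 0 j).
  rewrite (_ : (fun _ => _) = (fun o => B s o 0 j - B t o 0 j)).
    by apply: measurable_funB; exact: fbm_measurable_coord.
  by apply/funext => o; rewrite !mxE.
have -> : 2 * sig / `|z| = sig / (`|z| / 2) by field; rewrite gt_eqF.
apply: le_trans (fbm1_incr_tail (fbm_components fB k) H0 s0 t0 d0 sig0 stsig _); last first.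
  by rewrite divr_gt0.
apply: le_pr; first exact: measurable_rV_ball.
  rewrite -[X in measurable X]setTI; apply: measurable_fun_le => //.
  by apply: measurableT_comp => //; apply: measurable_funB; exact: fbm_measurable_coord.
move=> o /= le1; have := le_trans (rV_norm_coord _ k) le1; rewrite !mxE => le2.
have := lerB_dist (z 0 k) (z 0 k - (B s o 0 k - B t o 0 k)).
by rewrite subKr -zk (distrC (z 0 k)); move: le2 zrho; lra.
Qed.

End fbm_vector.

Section constants.
Context {R : realType}.
Variables (d : nat) (alpha beta gamma M : R).

Definition lacq : R := 2 `^ (- alpha).

Definition gpos : R := Num.max gamma 0.

(** Half of the amplitude of the random shift. It leaves room for [B], whose norm
    is at most [2 * d%:R] with probability at least one half, for the diameter of
    [F], for the other terms of the random sum and for the error [eta <= 1]. *)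
Definition halfL : R := `|M| + 2 * d%:R + 2 / (1 - lacq) + 1.

(** The first term serves when the target is within a constant times the
    amplitude [lacq ^+ m], the second one when the Gaussian tail is used. *)
Definition near_cst : R :=
  (2 * (osc_cst lacq + 2)) ^+ d + tail_cst d * 4 ^+ d.

(** The ratio of the geometric series over the scales in the second moment. *)
Definition lac_ratio : R := 2 `^ (- beta) * lacq `^ gpos / lacq ^+ d.

(** The constant of [hitting_lower_bound], with the loss of [space_net] in the
    comparison of the discrete energy with that of the measure. *)
Definition hit_cst : R :=
  ((2 * (2 * halfL)) ^- d) ^+ 2 / (4 * (15 ^+ d * near_cst * 8 * (1 - lac_ratio)^-1))
  / (3 * d%:R) ^+ d.

Hypotheses (d0 : (0 < d)%N) (alpha01 : 0 < alpha < 1).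
Hypotheses (beta0 : 0 < beta).

Lemma powR2_lt (x y : R) : x < y -> 2 `^ x < 2 `^ y :> R.
Proof.
move=> xy; rewrite /powR pnatr_eq0/= ltr_expR ltr_pM2r//.
by rewrite ln_gt0// ltr1n.
Qed.

Lemma lacq_half : 1 / 2 < lacq.
Proof.
have /andP[a0 a1] := alpha01.
rewrite div1r -(powR_inv1 (ler0n _ 2)); apply: powR2_lt; lra.
Qed.

Lemma lacq_lt1 : lacq < 1.
Proof.
have /andP[a0 a1] := alpha01.
by rewrite -[ltRHS](powRr0 2); apply: powR2_lt; lra.
Qed.

Lemma lacq_gt0 : 0 < lacq. Proof. by rewrite powR_gt0. Qed.

Lemma lacqX m : lacq ^+ m = (2 ^- m) `^ alpha.
Proof.
by rewrite -powR_mulrn ?powR_ge0// -powRrM mulNr mulrC -mulNr powRrM powR_invn.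
Qed.

Lemma lac_ratio_lt1 : alpha * (d%:R - gpos) < beta -> lac_ratio < 1.
Proof.
move=> h; rewrite /lac_ratio ltr_pdivrMr ?exprn_gt0 ?lacq_gt0// mul1r.
rewrite -(powR_mulrn _ (ltW lacq_gt0)) /lacq -!powRrM -powRD; last first.
  by rewrite pnatr_eq0 implybT.
by apply: powR2_lt; lra.
Qed.

Lemma near_cst_gt0 : 0 < near_cst.
Proof.
have h1 := osc_cst_ge1 lacq_half lacq_lt1.
rewrite ltr_wpDr ?mulr_ge0 ?tail_cst_ge0 ?exprn_ge0// exprn_gt0//.
by rewrite mulr_gt0//; lra.
Qed.

Lemma halfL_ge1 : 1 <= halfL.
Proof.
have h1 := lacq_lt1; have a0 : 0 <= 2 / (1 - lacq) by rewrite divr_ge0//; lra.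
have m0 := normr_ge0 M; have D0 : 0 <= d%:R :> R by [].
by rewrite /halfL; lra.
Qed.

Lemma hit_cst_gt0 : alpha * (d%:R - gpos) < beta -> 0 < hit_cst.
Proof.
move=> /lac_ratio_lt1 rho1; have L1 := halfL_ge1; have n0 := near_cst_gt0.
have D0 : 0 < d%:R :> R by rewrite ltr0n.
have L0 : 0 < halfL by lra.
have Z0 : 0 < (1 - lac_ratio)^-1 by rewrite invr_gt0 subr_gt0.
apply: divr_gt0; last by rewrite exprn_gt0// mulr_gt0.
apply: divr_gt0; first by rewrite exprn_gt0// invr_gt0 exprn_gt0// !mulr_gt0.
by rewrite mulr_gt0// mulr_gt0// mulr_gt0// mulr_gt0// exprn_gt0.
Qed.

(** For increments at time scale [2 ^- m], the Gaussian tail decays faster than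
    the power [gpos <= d] of the ratio between the amplitude [lacq ^+ m] of the
    random function and the distance [z]. *)
Lemma fbm_near_le (H : R) (disp : measure_display) (T : measurableType disp)
    (P : probability T R) (B : R -> T -> 'rV[R]_d) (s t eta : R) (z : 'rV[R]_d)
    (m : nat) :
  0 < H -> alpha <= H -> gamma <= d%:R ->
  is_fbm P H B -> 0 <= s -> 0 <= t ->
  `|s - t| <= 2 * 2 ^- m -> H <= 1 -> 0 < eta <= lacq ^+ m ->
  pr P [set o | `|B s o - B t o - z| <= (osc_cst lacq + 2) * lacq ^+ m] <=
  near_cst * (lacq `^ gpos) ^+ m * (Num.max `|z| eta) `^ (- gpos).
Proof.
move=> H0 aH gd fB s0 t0 st H1 /andP[eta0 etam].
have /andP[a0 a1] := alpha01.
have q0 := lacq_gt0; have qm0 : 0 < lacq ^+ m by rewrite exprn_gt0.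
have o1 := osc_cst_ge1 lacq_half lacq_lt1.
set C' := osc_cst lacq + 2; have C'3 : 3 <= C' by rewrite /C'; lra.
have gpos0 : 0 <= gpos by rewrite le_max lexx orbT.
have gposd : gpos <= d%:R by rewrite ge_max gd ler0n.
set zeta := Num.max _ _.
have zeta0 : 0 < zeta by rewrite lt_max eta0 orbT.
have -> : near_cst * (lacq `^ gpos) ^+ m * zeta `^ (- gpos) =
    near_cst * (lacq ^+ m / zeta) `^ gpos.
  rewrite -mulrA; congr (_ * _); rewrite powRM ?(ltW qm0) ?invr_ge0 ?(ltW zeta0)//.
  congr (_ * _).
    by rewrite -powR_mulrn ?powR_ge0// powRAC powR_mulrn ?(ltW q0).
  by rewrite -(powR_inv1 (ltW zeta0)) -powRrM mulN1r.
have mB k (r : R) : 0 <= r -> measurable_fun setT (fun o => B r o 0 k).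
  exact: (fbm_measurable_coord fB).
have mS : measurable [set o | `|B s o - B t o - z| <= C' * lacq ^+ m].
  apply: measurable_rV_ball; last by rewrite mulr_ge0 ?(ltW qm0)//; lra.
  move=> k; rewrite (_ : (fun _ => _) = (fun o => B s o 0 k - B t o 0 k)).
    by apply: measurable_funB; exact: mB.
  by apply/funext => o; rewrite !mxE.
have [small|large] := leP zeta (2 * C' * lacq ^+ m).
  apply: le_trans (pr_le1 P mS) _.
  have C'2 : 1 <= 2 * C' by lra.
  have C'20 : 0 < 2 * C' by lra.
  apply: (@le_trans _ _ ((2 * C') ^+ d * (lacq ^+ m / zeta) `^ gpos)); last first.
    by rewrite ler_wpM2r ?powR_ge0// /near_cst lerDl mulr_ge0 ?tail_cst_ge0 ?exprn_ge0.
  apply: (@le_trans _ _ ((2 * C') `^ gpos * (lacq ^+ m / zeta) `^ gpos)).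
    rewrite -powRM ?(ltW C'20) ?divr_ge0 ?(ltW qm0) ?(ltW zeta0)//.
    apply: (@le_trans _ _ (1 `^ gpos)); first by rewrite powR1.
    have big1' : 1 <= 2 * C' * (lacq ^+ m / zeta).
      by rewrite mulrA ler_pdivlMr// mul1r.
    by apply: ge0_ler_powR; rewrite ?nnegrE// (le_trans _ big1').
  rewrite ler_wpM2r ?powR_ge0// -powR_mulrn ?(ltW C'20)//.
  exact: ler_powR.
have zE : zeta = `|z|.
  rewrite /zeta; apply/max_idPl; rewrite leNgt; apply/negP => zeta_eta.
  move: large; rewrite /zeta (max_r (ltW zeta_eta)) ltNge => /negP; apply.
  by rewrite (le_trans etam)// ler_peMl ?(ltW qm0)//; lra.
rewrite zE in large zeta0 *.
have sig0 : 0 < 2 * lacq ^+ m by rewrite mulr_gt0.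
have stsig : `|s - t| `^ H <= 2 * lacq ^+ m.
  apply: (@le_trans _ _ ((2 * 2 ^- m) `^ H)).
    by apply: ge0_ler_powR; rewrite ?nnegrE ?(ltW H0) ?mulr_ge0 ?invr_ge0 ?exprn_ge0.
  rewrite powRM ?invr_ge0 ?exprn_ge0//; apply: ler_pM; rewrite ?powR_ge0//.
    by apply: ler1_powR => //; rewrite ler1n.
  rewrite lacqX; apply: ger_powR => //.
  by rewrite invr_gt0 exprn_gt0// invf_le1 ?exprn_gt0// exprn_ege1// ler1n.
apply: le_trans (fbm_incr_near d0 fB H0 s0 t0 sig0 stsig _ _) _.
- by rewrite mulr_ge0 ?(ltW qm0)//; lra.
- by rewrite mulrA.
have -> : 2 * (2 * lacq ^+ m) / `|z| = 4 * (lacq ^+ m / `|z|) by field; rewrite gt_eqF.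
have X0 : 0 < lacq ^+ m / `|z| by rewrite divr_gt0.
have X1 : lacq ^+ m / `|z| <= 1.
  rewrite ler_pdivrMr// mul1r (le_trans _ (ltW large))// ler_peMl ?(ltW qm0)//; lra.
rewrite exprMn mulrA.
apply: (@le_trans _ _ (tail_cst d * 4 ^+ d * (lacq ^+ m / `|z|) `^ gpos)).
  rewrite ler_wpM2l ?mulr_ge0 ?tail_cst_ge0 ?exprn_ge0//.
  by rewrite -[leLHS]powR_mulrn ?(ltW X0)//; apply: ger_powR; rewrite ?X0.
rewrite ler_wpM2r ?powR_ge0// /near_cst lerDr exprn_ge0// mulr_ge0//; lra.
Qed.

End constants.

(** * Approximate hitting at a finite scale *)

Section approximation.
Context {R : realType}.

Lemma exists_dyadic_lt (x : R) : 0 < x -> exists n, 2 ^- n < x.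
Proof.
move=> x0; exists (Num.truncn x^-1).+1.
rewrite invf_plt ?posrE ?exprn_gt0//.
apply: lt_trans (truncnS_gt _) _.
by rewrite -natrX ltr_nat ltn_expl.
Qed.

Lemma lac_sub_le (q L : R) (N : nat) (u v : R) : 1 / 2 < q -> q < 1 ->
  \sum_j `|lac (N := N) q L u j - lac q L v j| <= osc_cst q.
Proof.
move=> q12 q1; rewrite (bigD1 None)//= subrr normr0 add0r.
apply: (@le_trans _ _ (2 / (1 - q) + 2 / (1 - q))).
  apply: le_trans (lerD (lac_bound L N q12 q1 u) (lac_bound L N q12 q1 v)).
  by rewrite -big_split/=; apply: ler_sum => j _; exact: ler_normB.
have a0 : 0 <= 8 / (2 * q - 1) by rewrite divr_ge0//; lra.
by rewrite /osc_cst; lra.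
Qed.

(** The oscillation bound at the dyadic scale of [`|u - v|]; the frequencies up to
    [2 ^ m] and those beyond are controlled whatever [N] is. *)
Lemma lac_holder (alpha L : R) (N : nat) (u v : R) : 0 < alpha < 1 ->
  \sum_j `|lac (N := N) (lacq alpha) L u j - lac (lacq alpha) L v j| <=
  2 * osc_cst (lacq alpha) * `|u - v| `^ alpha.
Proof.
move=> alpha01; have /andP[a0 a1] := alpha01.
have q12 := lacq_half alpha01; have q1 := lacq_lt1 alpha01.
have o1 := osc_cst_ge1 q12 q1.
have [uv1|uv1] := leP 1 `|u - v|.
  apply: le_trans (lac_sub_le _ _ _ _ q12 q1) _.
  have : 1 <= `|u - v| `^ alpha.
    by rewrite -[leLHS](powRr0 `|u - v|); apply: ler_powR => //; exact: ltW.
  by nra.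
have [->|uv] := eqVneq u v.
  by rewrite big1 ?mulr_ge0 ?powR_ge0//; [lra|move=> j _; rewrite subrr normr0].
have uv0 : 0 < `|u - v| by rewrite normr_gt0 subr_eq0.
have [n hn] := exists_dyadic_lt uv0.
have [|m mn [uvm hm]] := @dyadic_scale R n `|u - v|; first by rewrite (ltW uv0) ltW.
have {}hm : 2 ^- m / 2 < `|u - v|.
  by case: hm => // mE; move: uvm; rewrite mE leNgt hn.
apply: le_trans (lac_osc _ _ q12 q1 uvm) _.
rewrite -mulrA mulrCA ler_wpM2l//; first lra.
rewrite lacqX; apply: (@le_trans _ _ ((2 * `|u - v|) `^ alpha)).
  by apply: ge0_ler_powR; rewrite ?nnegrE ?(ltW a0) ?mulr_ge0 ?invr_ge0 ?exprn_ge0//; lra.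
rewrite powRM// ler_wpM2r ?powR_ge0//.
by apply: ler1_powR; rewrite ?ler1n ?ltW.
Qed.

Lemma rV_norm_le_enorm (d : nat) (v : 'rV[R]_d) : `|v| <= enorm v.
Proof.
apply/(rV_norm_leP _ (enorm_ge0 v)) => k; rewrite -sqrtr_sqr ler_wsqrtr//.
by rewrite (bigD1 k)//= lerDl sumr_ge0// => i _; rewrite sqr_ge0.
Qed.

(** The Holder bound and the bound on the values do not depend on [N], in view of
    the limit. *)
Lemma approx_hit (d : nat) (H alpha beta gamma M : R)
    (disp : measure_display) (T : measurableType disp) (P : probability T R)
    (B : R -> T -> 'rV[R]_d) (E : set R) (F : set 'rV[R]_d)
    (Q : probability (measurableTypeR R) R) (a r : R)
    (mu : probability (borelRd R d) R) (y0 : 'rV[R]_d) (En : R) (N : nat) :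
  (0 < d)%N -> 0 < H < 1 -> 0 < beta <= 1 -> 0 < alpha < H ->
  gamma <= d%:R -> alpha * (d%:R - gpos gamma) < beta ->
  is_fbm P H B -> E `<=` `[0, 1] -> compact E -> 0 < r <= 1 ->
  Q (E `&` `[a - r, a + r]) = 1%E ->
  (forall x del : R, E x -> 0 < del ->
     pr Q `[x - del, x + del] <= 2 * (del / r) `^ beta) ->
  compact F -> (forall x y, F x -> F y -> enorm (x - y) <= M) -> F y0 ->
  mu.-negligible (~` F) -> (riesz_energy gamma mu <= En%:E)%E -> 0 < En ->
  exists f : R -> 'rV[R]_d,
    [/\ forall s t, `|f s - f t| <=
          2 * osc_cst (lacq alpha) * (2 * r)^-1 `^ alpha * `|s - t| `^ alpha,
        forall t, `|f t - y0| <= 4 * halfL d alpha M &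
        exists A, [/\ measurable A, hit_cst d alpha beta gamma M / En <= pr P A &
          A `<=` [set o | exists t x, [/\ E t, F x &
            `|B t o + f t - x| <= lacq alpha ^+ N]]]].
Proof.
move=> d0 /andP[H0 H1] beta01 /andP[al0 alH] gd ratio fB E01 cE /andP[r0 r1] QA Qreg cF
  FM Fy0 muF muE En0.
have alpha01 : 0 < alpha < 1 by rewrite al0 (lt_trans alH).
have /andP[beta0 beta1] := beta01.
have q12 := lacq_half alpha01; have q1 := lacq_lt1 alpha01.
have q0 := lacq_gt0 alpha.
have o1 := osc_cst_ge1 q12 q1.
set q := lacq alpha in q12 q1 q0 o1 *.
have eta0 : 0 < q ^+ N by rewrite exprn_gt0.
have eta1 : q ^+ N <= 1 by rewrite exprn_ile1// ltW.
have L1 := halfL_ge1 d M alpha01; set L2 := halfL d alpha M in L1 *.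
pose L := 2 * L2.
have q20 : 0 <= 2 / (1 - q) by rewrite divr_ge0//; lra.
have [n [t [w [tE w0 w1 mass]]]] := time_net N beta01 cE r0 QA Qreg.
have [n' [x [m [xF m0 m1 energy]]]] := space_net d0 cF muF gd eta0.
pose u i := (t i - a) / (2 * r).
have r20 : 0 < 2 * r by rewrite mulr_gt0.
have uE i j : `|u i - u j| = `|t i - t j| / (2 * r).
  rewrite /u -mulrBl normrM [X in _ * X]ger0_norm ?invr_ge0 ?(ltW r20)//.
  by congr (`|_| / _); ring.
have u1 i j : 0 <= `|u i - u j| <= 1.
  rewrite normr_ge0 uE ler_pdivrMr// mul1r/=.
  have [_ hi] := tE i; have [_ hj] := tE j.
  apply: le_trans (ler_distD a (t i) (t j)) _.
  by rewrite (distrC a) mulr_natl mulr2n lerD.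
have hms (p : 'I_n * 'I_n) : exists k : 'I_N.+1, `|u p.1 - u p.2| <= 2 ^- k /\
    (k = N :> nat \/ 2 ^- k / 2 < `|u p.1 - u p.2|).
  have [k kN hk] := dyadic_scale N (u1 p.1 p.2).
  by exists (Ordinal (kN : (k < N.+1)%N)).
pose ms i j := projT1 (cid (hms (i, j))).
have ms_le i j : `|u i - u j| <= 2 ^- ms i j.
  by rewrite /ms; case: cid => k [].
have ms_max i j : ms i j = N :> nat \/ 2 ^- ms i j / 2 < `|u i - u j|.
  by rewrite /ms; case: cid => k [].
have [D hD] : exists D : nat, 4 * L / q ^+ N <= D.+1%:R.
  by exists (Num.truncn (4 * L / q ^+ N)); exact/ltW/truncnS_gt.
pose c := y0 - const_mx L2.
have t01 i : 0 <= t i <= 1 by have [/E01] := tE i; rewrite /= in_itv.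
have t0 i : 0 <= t i by have /andP[] := t01 i.
pose Bt i o := B (t i) o.
have mBt i k : measurable_fun setT (fun o => Bt i o 0 k).
  by apply: (fbm_measurable_coord fB).
pose G (j j' : 'I_n') := (Num.max `|x j - x j'| (q ^+ N)) `^ (- gpos gamma).
have D30 : 0 < 3 * d%:R :> R by rewrite mulr_gt0// ltr0n.
have GE : \sum_j \sum_j' m j * m j' * G j j' <= (3 * d%:R) ^+ d * En.
  by rewrite -ler_pdivrMl ?exprn_gt0// -lee_fin (le_trans energy).
have L10 : 1 <= L by rewrite /L; lra.
have hbox i j k o : `|Bt i o| <= 2 * d%:R ->
    q ^+ N + 2 / (1 - q) <= (x j - (Bt i o + c)) 0 k <= L - 2 / (1 - q).
  move=> Bo; have hB := le_trans (rV_norm_coord (Bt i o) k) Bo.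
  have hx : `|(x j - y0) 0 k| <= `|M|.
    apply: le_trans (rV_norm_coord _ _) _.
    apply: le_trans (rV_norm_le_enorm _) _.
    by apply: le_trans (FM _ _ (xF j) Fy0) _; exact: ler_norm.
  move: hx hB; rewrite /L /c !mxE !ler_norml /L2 /halfL -/q => /andP[h1 h2] /andP[h3 h4].
  move: q20 eta1 h1 h2 h3 h4; move: (2 / (1 - q)) (q ^+ N) => Z e.
  by clear; move=> *; apply/andP; split; lra.
have bb0 : 0 <= 2 * d%:R :> R by rewrite mulr_ge0.
have hbb i : 2^-1 <= pr P [set o | `|Bt i o| <= 2 * d%:R].
  exact: (fbm_box d0 fB H0 (t01 i)).
have En30 : 0 < (3 * d%:R) ^+ d * En by rewrite mulr_gt0 ?exprn_gt0.
have hnear i i' j j' (k : 'I_N.+1) : `|u i - u i'| <= 2 ^- k ->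
    pr P [set o | `|Bt i o - Bt i' o - (x j - x j')| <= (osc_cst q + 2) * q ^+ k]
    <= near_cst d alpha * (q `^ gpos gamma) ^+ k * G j j'.
  move=> uk.
  have tk : `|t i - t i'| <= 2 * 2 ^- k.
    move: uk; rewrite uE ler_pdivrMr// => tk; apply: le_trans tk _.
    rewrite mulrC ler_wpM2r ?invr_ge0 ?exprn_ge0//.
    by rewrite ler_piMr.
  have qk : 0 < q ^+ N <= q ^+ k.
    rewrite eta0/=; apply: ler_wiXn2l; rewrite ?(ltW q0) ?(ltW q1)//.
    by rewrite -ltnS.
  exact: (fbm_near_le d0 alpha01 _ H0 (ltW alH) gd fB (t0 i) (t0 i') tk (ltW H1) qk).
have hmass i (k : 'I_N.+1) : \sum_i' w i' * (`|u i - u i'| <= 2 ^- k)%R%:R <=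
    8 * (2 `^ (- beta)) ^+ k.
  apply: le_trans (mass i k); apply: ler_sum => i' _.
  by rewrite uE ler_pdivrMr// [_ * (2 * r)]mulrC.
have [V hV] := hitting_lower_bound q12 q1 w0 m0 m1 ms_le ms_max L10 hD
  bb0 w1 mBt hbb hbox (powR_ge0 q (gpos gamma)) (powR_ge0 2 (- beta))
  (lac_ratio_lt1 ratio) (near_cst_gt0 d alpha01)
  (ltr0n R 8) En30 (fun j j' => powR_ge0 _ _) GE hnear hmass.
exists (fun s => c + lacf q L V ((s - a) / (2 * r))); split.
- move=> s1 s2; rewrite opprD addrACA subrr add0r.
  have K0 : 0 <= 2 * osc_cst q * (2 * r)^-1 `^ alpha by rewrite mulr_ge0 ?powR_ge0//; lra.
  apply/rV_norm_leP => [|k]; first by rewrite mulr_ge0 ?powR_ge0.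
  rewrite !mxE -lformB; apply: le_trans (ler_norm_lform _ _) _.
  apply: le_trans (lac_holder L N _ _ alpha01) _.
  rewrite -[leRHS]mulrA ler_wpM2l//; first by rewrite mulr_ge0//; lra.
  rewrite -mulrBl opprB addrA subrK normrM powRM// mulrC ger0_norm//.
  by rewrite invr_ge0 ltW.
- move=> s.
  apply/rV_norm_leP => [|k]; first by rewrite mulr_ge0//; lra.
  rewrite /c !mxE.
  have hs : `|lform (lac q L ((s - a) / (2 * r))) (V k)| <= L + 2 / (1 - q).
    apply: le_trans (ler_norm_lform _ _) _; rewrite (bigD1 None)//= lerD//.
      by rewrite ger0_norm//; lra.
    exact: lac_bound.
  have : 2 / (1 - q) <= L2.
    rewrite /L2 /halfL -/q; have := normr_ge0 M; have := bb0.
    by move: (2 / (1 - q)) (2 * d%:R) => *; lra.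
  by move: hs; rewrite !ler_norml /L => /andP[]; lra.
exists [set o | hits q L u x c (fun i => Bt i o) V]; split.
- exact: measurable_hits.
- apply: le_trans hV; rewrite /hit_cst -/L2 -/L -/q -/(lac_ratio d alpha beta gamma).
  rewrite le_eqVlt; apply/orP; left; apply/eqP.
  by move: (_ / (4 * _)) => X; rewrite invfM mulrA.
move=> o /existsP[[i j] /= hit]; exists (t i), (x j); split => //.
  by have [] := tE i.
apply: le_trans hit; rewrite le_eqVlt; apply/orP; left; apply/eqP.
by congr (`|_|); apply/rowP => k; rewrite !mxE /Bt /u; ring.
Qed.

End approximation.

(** * Passage to the limit *)

Section limit.
Context {R : realType}.

Lemma powR_small (K alpha e : R) : 0 < alpha -> 0 < e ->
  exists2 del, 0 < del & forall x, 0 <= x -> x <= del -> K * x `^ alpha <= e.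
Proof.
move=> a0 e0; have K0 : 0 < `|K| + 1 by rewrite ltr_wpDl.
exists ((e / (`|K| + 1)) `^ alpha^-1); first by rewrite powR_gt0// divr_gt0.
move=> x x0 xd; apply: (@le_trans _ _ ((`|K| + 1) * x `^ alpha)).
  rewrite ler_wpM2r ?powR_ge0// (le_trans (ler_norm _))// lerDl//.
rewrite -ler_pdivlMl// mulrC.
apply: (@le_trans _ _ (((e / (`|K| + 1)) `^ alpha^-1) `^ alpha)).
  by apply: ge0_ler_powR; rewrite ?nnegrE ?(ltW a0) ?powR_ge0.
by rewrite -powRrM mulVf ?gt_eqF// powRr1// divr_ge0 ?(ltW e0) ?(ltW K0).
Qed.

(** Tychonoff gives a pointwise cluster point; equicontinuity makes the
    convergence uniform on [[0, 1]]. *)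
Lemma holder_cluster (d : nat) (f_ : nat -> R -> 'rV[R]_d) (y0 : 'rV[R]_d)
    (K Kb alpha : R) : 0 < alpha ->
  (forall N s t, `|f_ N s - f_ N t| <= K * `|s - t| `^ alpha) ->
  (forall N t, `|f_ N t - y0| <= Kb) ->
  exists f : R -> 'rV[R]_d, (forall s t, `|f s - f t| <= K * `|s - t| `^ alpha) /\
    forall (e : R) n, 0 < e -> exists2 N, (n <= N)%N &
      forall t : R, 0 <= t <= 1 -> `|f_ N t - f t| <= e.
Proof.
move=> a0 fK fKb.
pose X : topologicalType := prod_topology (fun _ : R => 'rV[R]_d).
pose A (t : R) := [set v : 'rV[R]_d | forall k,
  `[y0 0 k - Kb, y0 0 k + Kb]%classic (v ord0 k)].
have cA t : compact (A t).
  by apply: (@rV_compact R d (fun k => `[y0 0 k - Kb, y0 0 k + Kb]%classic)) => k; exact: segment_compact.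
have cX := @tychonoff R (fun _ => 'rV[R]_d) A cA.
have [|f [_ fcl]] := cX ((f_ : nat -> X) @ \oo) _.
  exists 0%N => // N _ t k /=; rewrite in_itv/= -ler_distl.
  have := le_trans (rV_norm_coord _ k) (fKb N t).
  by rewrite !mxE distrC.
have near_f (ts : seq R) e n : 0 < e -> exists2 N, (n <= N)%N &
    forall t, t \in ts -> `|f_ N t - f t| < e.
  move=> e0.
  have F1 : ((f_ : nat -> X) @ \oo) [set g | exists2 N, (n <= N)%N & f_ N = g].
    by exists n => // N /= nN; exists N.
  have F2 : nbhs (f : X) [set g : X | forall t, t \in ts -> `|g t - f t| < e].
    elim: ts => [|t ts IH]; first by apply: filterE => g.
    have Ft : nbhs (f : X) [set g : X | `|g t - f t| < e].
      have Ft : nbhs (f : X) ((fun g : X => g t) @^-1` ball (f t) e).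
        exact: (@proj_continuous R (fun _ => 'rV[R]_d) t f _ (nbhsx_ballx _ _ e0)).
      by apply: filterS Ft => g /=; rewrite -ball_normE /= distrC.
    apply: filterS2 Ft IH => g /= gt gts s.
    by rewrite in_cons => /orP[/eqP ->//|]; exact: gts.
  have [g [[N nN <-] gts]] := fcl _ _ F1 F2.
  by exists N.
have fH s t : `|f s - f t| <= K * `|s - t| `^ alpha.
  apply/ler_addgt0Pr => e e0.
  have e20 : 0 < e / 2 by rewrite divr_gt0.
  have [N _ hN] := near_f [:: s; t] (e / 2) 0%N e20.
  have hs : `|f_ N s - f s| < e / 2 by apply: hN; rewrite inE eqxx.
  have ht : `|f_ N t - f t| < e / 2 by apply: hN; rewrite !inE eqxx orbT.
  have -> : f s - f t = (f s - f_ N s) + (f_ N s - f_ N t) + (f_ N t - f t).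
    by rewrite (addrA (f s - _)) subrK (addrA (f s - _)) subrK.
  apply: le_trans (ler_normD _ _) _.
  apply: le_trans (lerD (ler_normD _ _) (ltW ht)) _.
  by rewrite distrC; have := fK N s t; move: hs; lra.
exists f; split => // e n e0.
have e40 : 0 < e / 4 by rewrite divr_gt0.
have [del del0 hdel] := powR_small K a0 e40.
have [m [c [c01 cov]]] := finite_net (@segment_compact R 0 1) del0.
have [N nN hN] := near_f (codom c) (e / 4) n e40.
exists N => // t t01.
have [i _ /interior_subset] : (\bigcup_i (ball (c i) del)^°) t.
  by apply: cov; rewrite /= in_itv.
rewrite /ball/= => /ltW ct.
have hc : `|f_ N (c i) - f (c i)| < e / 4 by apply: hN; exact: codom_f.
have h1 : `|f_ N t - f_ N (c i)| <= e / 4.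
  by apply: le_trans (fK N _ _) _; apply: hdel => //; rewrite distrC.
have h2 : `|f (c i) - f t| <= e / 4.
  by apply: le_trans (fH _ _) _; exact: hdel.
have -> : f_ N t - f t = (f_ N t - f_ N (c i)) + (f_ N (c i) - f (c i)) + (f (c i) - f t).
  by rewrite (addrA (f_ N t - _)) subrK (addrA (f_ N t - _)) subrK.
apply: le_trans (ler_normD _ _) _.
apply: le_trans (lerD (ler_normD _ _) (lexx _)) _.
by move: h1 h2 hc; lra.
Qed.

Lemma within_continuous_eps (V : normedModType R) (A : set R) (h : R -> V) (t e : R) :
  {within A, continuous h} -> A t -> 0 < e ->
  exists2 del, 0 < del & forall s, A s -> `|t - s| < del -> `|h t - h s| < e.
Proof.
move=> /subspace_continuousP hc At e0.
have /cvgrPdist_lt /(_ _ e0) := hc _ At.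
rewrite /within/= => /nbhs_ballP[del /= del0 hdel].
exists del => // s As ts.
by apply: (hdel s).
Qed.

Section hit_limit.
Context {disp : measure_display} {T : measurableType disp}.
Variables (P : probability T R) (d : nat) (B : R -> T -> 'rV[R]_d).
Variables (E : set R) (F : set 'rV[R]_d) (f : R -> 'rV[R]_d) (K alpha : R).
Hypotheses (Pcomplete : measure_is_complete P).
Hypothesis mB : forall (t : R) k, 0 <= t -> measurable_fun setT (fun o => B t o 0 k).
Hypothesis Bcont : {ae P, forall w,
    {within [set t : R | 0 <= t], continuous (fun t => B t w)}}.
Hypotheses (E0 : E `<=` [set t | 0 <= t]) (cE : compact E) (cF : compact F).
Hypotheses (a0 : 0 < alpha).
Hypothesis fH : forall s t, `|f s - f t| <= K * `|s - t| `^ alpha.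

Definition near_hit (e : R) : set T :=
  [set o | exists t x, [/\ E t, F x & `|B t o + f t - x| <= e]].

Definition hit : set T := [set w | [set (B t w + f t)%R | t in E] `&` F !=set0].

Lemma near_hit0 o : near_hit 0 o <-> hit o.
Proof.
split=> [[t [x [Et Fx]]]|[x [[t Et <-] Fx]]]; last first.
  by exists t, (B t o + f t); rewrite subrr normr0.
rewrite normr_le0 subr_eq0 => /eqP tx.
by exists x; split => //; exists t.
Qed.

Lemma path_eps o (t e : R) : {within [set t : R | 0 <= t], continuous (fun t => B t o)} ->
  E t -> 0 < e ->
  exists2 del, 0 < del & forall s, E s -> `|t - s| < del ->
    `|(B t o + f t) - (B s o + f s)| < e.
Proof.
move=> oc Et e0; have e20 : 0 < e / 2 by rewrite divr_gt0.
have e40 : 0 < e / 4 by rewrite divr_gt0.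
have [del1 del10 h1] := within_continuous_eps oc (E0 Et) e20.
have [del2 del20 h2] := powR_small K a0 e40.
exists (Num.min del1 del2); first by rewrite lt_min del10.
move=> s Es; rewrite lt_min => /andP[ts1 ts2].
rewrite opprD addrACA; apply: le_lt_trans (ler_normD _ _) _.
have := h1 s (E0 Es) ts1.
have := le_trans (fH t s) (h2 _ (normr_ge0 _) (ltW ts2)); lra.
Qed.

(** A cluster point of approximate encounters is an encounter. *)
Lemma near_hit_lim o : {within [set t : R | 0 <= t], continuous (fun t => B t o)} ->
  (forall e : R, 0 < e -> near_hit e o) -> hit o.
Proof.
move=> oc nh.
have e0 n : 0 < 2 ^- n :> R by rewrite invr_gt0 exprn_gt0.
have /choice[p hp] : forall n, exists p : R * 'rV[R]_d,
    [/\ E p.1, F p.2 & `|B p.1 o + f p.1 - p.2| <= 2 ^- n].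
  by move=> n; have [t [x h]] := nh _ (e0 n); exists (t, x).
have cEF := compact_setX cE cF.
have [|[t x] [[/= Et Fx] cl]] := cEF (p @ \oo) _.
  by exists 0%N => // n _; have [] := hp n; split.
apply/near_hit0; exists t, x; split => //.
apply/ler_addgt0Pr => e e0'; rewrite add0r.
have e40 : 0 < e / 4 by rewrite divr_gt0.
have [del del0 hdel] := path_eps oc Et e40.
have [n0 hn0] := exists_dyadic_lt e40.
have F1 : (p @ \oo) [set z | exists2 n, (n0 <= n)%N & p n = z].
  by exists n0 => // n /= n0n; exists n.
have F2 : nbhs (t, x) (ball t del `*` ball x (e / 4)).
  by exists (ball t del, ball x (e / 4)) => //; split; exact: nbhsx_ballx.
have [z [[n n0n <-]]] := cl _ _ F1 F2.
rewrite -!ball_normE /= => -[tp xp].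
have [Ep Fp pn] := hp n.
have h1 := hdel _ Ep tp.
have h2 : 2 ^- n <= 2 ^- n0 :> R.
  by rewrite lef_pV2 ?posrE ?exprn_gt0// ler_eXn2l ?ltr1n.
have -> : B t o + f t - x = (B t o + f t - (B (p n).1 o + f (p n).1)) +
    (B (p n).1 o + f (p n).1 - (p n).2) + ((p n).2 - x).
  by rewrite (addrA (B t o + f t - _)) subrK (addrA (B t o + f t - _)) subrK.
apply: le_trans (ler_normD _ _) _.
apply: le_trans (lerD (ler_normD _ _) (lexx _)) _.
rewrite (distrC _ x); move: h1 h2 hn0 pn xp.
by move: (2 ^- n) (2 ^- n0) => *; lra.
Qed.

(** Along countable dense subsets of [E] and [F] the approximate hitting event
    becomes measurable. *)
Lemma near_hit_measurable_approx : exists S : R -> set T,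
  [/\ forall e : R, 0 <= e -> measurable (S e), forall e e', e <= e' -> S e `<=` S e',
      forall e, S e `<=` near_hit e &
      forall (e : R) o, 0 < e -> near_hit e o ->
        {within [set t : R | 0 <= t], continuous (fun t => B t o)} -> S (2 * e) o].
Proof.
have net (V : normedModType R) (A : set V) : compact A -> exists s : nat -> seq V,
    (forall n x, x \in s n -> A x) /\
    (forall n x, A x -> exists2 y, y \in s n & `|x - y| < 2 ^- n).
  move=> cA; have /choice[s hs] : forall n, exists s : seq V,
      (forall x, x \in s -> A x) /\
      (forall x, A x -> exists2 y, y \in s & `|x - y| < 2 ^- n).
    move=> n; have e0 : 0 < 2 ^- n :> R by rewrite invr_gt0 exprn_gt0.
    have [m [c [cA' cov]]] := finite_net cA e0.
    exists (codom c); split => [x /codomP[i ->]//|x Ax].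
    have [i _ /interior_subset] := cov _ Ax; rewrite -ball_normE /= => h.
    by exists (c i); [exact: codom_f|rewrite distrC].
  by exists s; split=> n; have [] := hs n.
have [sE [sEE dE]] := net R E cE.
have [sF [sFF dF]] := net 'rV[R]_d F cF.
pose S e := \bigcup_n \bigcup_(p in [set` [seq (t, x) | t <- sE n, x <- sF n]])
  [set o | `|B p.1 o + f p.1 - p.2| <= e].
exists S; split.
- move=> e e0; apply: bigcup_measurable => n _.
  apply: fin_bigcup_measurable; first exact: finite_seq.
  move=> [t x] /= /allpairsP[[t' x'] /= [t's _ [-> _]]].
  under eq_set do rewrite -addrA -opprB.
  by apply: measurable_rV_ball => // k; apply: mB; apply: E0; exact: sEE t's.
- move=> e e' ee' o [n _ [p hp /= h]]; exists n => //; exists p => //=.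
  exact: le_trans ee'.
- move=> e o [n _ [[t x] /= /allpairsP[[t' x'] /= [ts xs [-> ->]]] h]].
  by exists t', x'; split => //; [exact: sEE ts|exact: sFF xs].
move=> e o e0 [t [x [Et Fx tx]]] oc.
have e20 : 0 < e / 2 by rewrite divr_gt0.
have [del del0 hdel] := path_eps oc Et e20.
have [n hn] : exists n, 2 ^- n < Num.min del (e / 2).
  by apply: exists_dyadic_lt; rewrite lt_min del0.
move: hn; rewrite lt_min => /andP[hn1 hn2].
have [t' t's tt'] := dE n _ Et; have [x' x's xx'] := dF n _ Fx.
exists n => //; exists (t', x') => /=; first by apply/allpairsP; exists (t', x').
have h1 := hdel _ (sEE _ _ t's) (lt_trans tt' hn1).
have -> : B t' o + f t' - x' = (B t' o + f t' - (B t o + f t)) +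
    (B t o + f t - x) + (x - x').
  by rewrite (addrA (B t' o + f t' - _)) subrK (addrA (B t' o + f t' - _)) subrK.
apply: le_trans (ler_normD _ _) _.
apply: le_trans (lerD (ler_normD _ _) (ltW xx')) _.
rewrite distrC; move: h1 tx hn2.
by move: (2 ^- n) => *; lra.
Qed.

(** Off a null set, the hitting event is the decreasing limit of the approximate
    ones; by completeness this makes it measurable. *)
Lemma hit_prob_ge (c : R) :
  (forall e : R, 0 < e -> exists A, [/\ measurable A, c <= pr P A & A `<=` near_hit e]) ->
  (c%:E <= P hit)%E.
Proof.
move=> hA.
have [S [mS homoS S_near near_S]] := near_hit_measurable_approx.
have [Z [mZ PZ0 Zc]] := Bcont.
have good o : ~ Z o -> {within [set t : R | 0 <= t], continuous (fun t => B t o)}.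
  by move=> nZ; apply: contrapT => h; apply: nZ; exact: Zc.
have prZ : pr P Z = 0 by rewrite /pr PZ0.
have prD (A : set T) : measurable A -> pr P (A `\` Z) = pr P A.
  move=> mA; apply/eqP; rewrite eq_le; apply/andP; split.
    by apply: le_pr; [exact: measurableD|exact: mA|move=> o []].
  have : pr P A <= pr P (A `\` Z) + pr P Z.
    rewrite -lee_fin EFinD -!prE//; last exact: measurableD.
    rewrite (measureDI P mA mZ); apply: leeD => //.
    by apply: le_measure; rewrite ?inE; [exact: measurableI|exact: mZ|move=> o []].
  by rewrite prZ addr0.
pose e n : R := 2 ^- n.
have e0 n : 0 < e n by rewrite /e invr_gt0 exprn_gt0.
pose G := \bigcap_n S (2 * e n).
have mSe n : measurable (S (2 * e n)) by apply: mS; rewrite mulr_ge0// ltW.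
have mG : measurable G by apply: bigcap_measurable => // n _.
have SE n : c <= pr P (S (2 * e n)).
  have [A [mA cA Anear]] := hA _ (e0 n).
  apply: le_trans cA _; rewrite -(prD _ mA); apply: le_pr => //.
    exact: measurableD.
  by move=> o [Ao nZ]; apply: near_S => //; [exact: Anear|exact: good].
have cG : (c%:E <= P G)%E.
  have cvgG : P \o (fun n => S (2 * e n)) @ \oo --> P G.
    apply: nonincreasing_cvg_mu => //.
      by rewrite (le_lt_trans (probability_le1 P (mSe 0%N)))// ltry.
    move=> m n mn; apply/subsetPset; apply: homoS.
    by rewrite ler_wpM2l// /e lef_pV2 ?posrE ?exprn_gt0// ler_eXn2l ?ltr1n.
  rewrite -(cvg_lim _ cvgG)//; apply: lime_ge; first by apply/cvg_ex; eexists; exact: cvgG.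
  by near=> n; rewrite /= prE// lee_fin.
have hitE : hit = (G `\` Z) `|` (hit `&` Z).
  apply/seteqP; split => o.
    move=> ho; have [Zo|nZ] := pselect (Z o); first by right.
    left; split => // n _; apply: near_S => //; last exact: good.
    have [t [x [Et Fx tx]]] := (near_hit0 o).2 ho.
    by exists t, x; split => //; apply: le_trans tx (ltW (e0 n)).
  move=> [[Go nZ]|[]//]; apply: near_hit_lim; first exact: good.
  move=> r r0; have r20 : 0 < r / 2 by rewrite divr_gt0.
  have [n hn] := exists_dyadic_lt r20.
  have [t [x [Et Fx tx]]] := S_near _ _ (Go n I).
  exists t, x; split => //; apply: le_trans tx _.
  by rewrite /e; move: hn; move: (2 ^- n) => *; lra.
have mhZ : measurable (hit `&` Z).
  by apply: Pcomplete; exists Z; split => //; exact: subIsetr.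
have mD : measurable (G `\` Z) by exact: measurableD.
have mhit : measurable hit by rewrite hitE; exact: measurableU.
apply: le_trans cG _; rewrite prE// -prD// -prE//.
apply: le_measure; rewrite ?inE//.
by rewrite [X in _ `<=` X]hitE; exact: subsetUl.
Unshelve. all: by end_near. Qed.

End hit_limit.
End limit.

(** * The Holder function and the capacity *)

(** The numerical inequality comes from probabilities being at most 1: it shows
    that the energies are bounded away from 0. *)
Lemma holder_hit (R : realType) (d : nat) (H alpha beta gamma M : R)
    (disp : measure_display) (T : measurableType disp) (P : probability T R)
    (B : R -> T -> 'rV[R]_d) (E : set R) (F : set 'rV[R]_d)
    (mu : probability (borelRd R d) R) (En : R) :
  (0 < d)%N -> 0 < H < 1 -> 0 < beta <= 1 -> 0 < alpha < H ->
  gamma <= d%:R -> alpha * (d%:R - gpos gamma) < beta ->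
  measure_is_complete P -> is_fbm P H B ->
  E `<=` `[0, 1] -> compact E -> beta_regular beta E ->
  compact F -> (forall x y, F x -> F y -> enorm (x - y) <= M) ->
  mu.-negligible (~` F) -> (riesz_energy gamma mu <= En%:E)%E -> 0 < En ->
  hit_cst d alpha beta gamma M / En <= 1 /\
  exists2 f : R -> 'rV[R]_d, holder_on01 alpha f &
    ((hit_cst d alpha beta gamma M / En)%:E <=
     P [set w | [set (B t w + f t)%R | t in E] `&` F !=set0])%E.
Proof.
move=> d0 H01 beta01 alH gd ratio Pc fB E01 cE regE cF FM muF muE En0.
have /andP[beta0 beta1] := beta01; have /andP[al0 alH'] := alH.
have /andP[H0 H1] := H01.
have alpha01 : 0 < alpha < 1 by rewrite al0 (lt_trans alH').
have [y0 Fy0] : exists y, F y.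
  apply: contrapT => /forallNP nF.
  have FC : ~` F = setT by apply/seteqP; split => // y _; exact: nF.
  have [A [_ muA sA]] := muF.
  have AT : A = setT by apply/seteqP; split => // y _; apply: sA; rewrite FC.
  have := @probability_setT _ _ _ mu; rewrite -AT muA => /eqP.
  by rewrite eq_sym onee_eq0.
have [Q [a [r [r01 QA Qreg]]]] := beta_regular_localize beta0 cE regE.
have happ N := approx_hit N d0 H01 beta01 alH gd ratio fB E01 cE r01 QA Qreg cF
  FM Fy0 muF muE En0.
split.
  have [_ [_ _ [A [mA hA _]]]] := happ 0%N.
  exact: le_trans hA (pr_le1 _ mA).
have /choice[f_ hf] := happ.
have [f [fH fcl]] := holder_cluster al0 (fun N => let: And3 h _ _ := hf N in h)
  (fun N => let: And3 _ h _ := hf N in h).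
exists f.
  exists (d%:R * (2 * osc_cst (lacq alpha) * (2 * r)^-1 `^ alpha)) => s t _ _.
  by apply: le_trans (enorm_le _) _; rewrite -mulrA ler_wpM2l.
have E0 : E `<=` [set t | 0 <= t].
  by move=> t /E01; rewrite /= in_itv/= => /andP[].
apply: (hit_prob_ge Pc _ (fbm_continuous fB) E0 cE cF al0 fH).
  by move=> t k t0; exact: (fbm_measurable_coord fB).
move=> e e0; have e20 : 0 < e / 2 by rewrite divr_gt0.
have [del del0 hdel] := powR_small 1 al0 e20.
have [n hn] := exists_dyadic_lt del0.
have [N nN fN] := fcl _ n e20.
have [_ _ [A [mA hA Anear]]] := hf N.
exists A; split => //; move=> o /Anear[t [x [Et Fx tx]]].
exists t, x; split => //.
have t01 : 0 <= t <= 1 by have := E01 _ Et; rewrite /= in_itv.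
have qN : lacq alpha ^+ N <= e / 2.
  rewrite lacqX -[leLHS]mul1r; apply: hdel; first by rewrite invr_ge0 exprn_ge0.
  apply: le_trans (ltW hn); rewrite lef_pV2 ?posrE ?exprn_gt0//.
  by rewrite ler_eXn2l ?ltr1n.
have -> : B t o + f t - x = (B t o + f_ N t - x) + (f t - f_ N t).
  by apply/rowP => k; rewrite !mxE; ring.
apply: le_trans (ler_normD _ _) _.
by have := fN t t01; rewrite distrC; move: tx qN; lra.
Qed.

Lemma hausdorff_dim_ge0 (R : realType) (d : nat) (F : set 'rV[R]_d) :
  (0 <= hausdorff_dim F)%E.
Proof. by apply: le_ereal_inf_tmp => _ [s [s0 _] <-]; rewrite lee_fin. Qed.

Lemma riesz_kernel_ge0 (R : realType) (gamma r : R) : 0 <= r ->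
  (0 <= riesz_kernel gamma r)%E.
Proof.
move=> r0; have [g0|g0] := leP gamma 0.
  by apply: le_trans (riesz_kernel_ge1 g0 r0); rewrite lee_fin.
rewrite /riesz_kernel ltNge (ltW g0)/=; case: ifPn => // _.
by rewrite gt_eqF// lee_fin powR_ge0.
Qed.

(** It is through this inequality that the dimension of [F] enters. *)
Lemma exponent_lt_hurst (R : realType) (d : nat) (F : set 'rV[R]_d)
    (H beta alpha : R) : 0 < H -> 0 < beta ->
  (hausdorff_dim F <= (d%:R - beta / H)%:E)%E ->
  alpha < beta / (d%:R - fine (hausdorff_dim F)) -> alpha < H.
Proof.
move=> H0 beta0 dimF /lt_le_trans; apply.
have b0 : 0 < beta / H by rewrite divr_gt0.
have dimE : hausdorff_dim F = (fine (hausdorff_dim F))%:E.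
  rewrite fineK// ge0_fin_numE ?hausdorff_dim_ge0//.
  by rewrite (le_lt_trans dimF)// ltry.
move: dimF; rewrite dimE lee_fin => dimF.
have g0 : beta / H <= d%:R - fine (hausdorff_dim F) by lra.
rewrite ler_pdivrMr; last exact: lt_le_trans g0.
by rewrite -ler_pdivrMl// mulrC.
Qed.

Theorem theorem2p11 (R : realType) (d : nat) (H beta alpha eps M : R) :
  (0 < d)%N -> 0 < H < 1 -> 0 < beta <= 1 -> 0 < alpha -> 0 < eps ->
  exists2 c1 : R, 0 < c1 &
  forall (disp : measure_display) (Omega : measurableType disp)
    (P : probability Omega R) (B : R -> Omega -> 'rV[R]_d)
    (eps0 : R) (E : set R) (F : set 'rV[R]_d),
    measure_is_complete P ->
    is_fbm P H B ->
    0 < eps0 < 1 ->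
    E `<=` `[eps0, 1] -> compact E -> beta_regular beta E ->
    compact F ->
    (forall x y, F x -> F y -> enorm (x - y) <= M) ->
    (hausdorff_dim F <= (d%:R - beta / H)%:E)%E ->
    alpha < beta / (d%:R - fine (hausdorff_dim F)) ->
    (0 < riesz_capacity (d%:R - beta / (alpha + eps)) F)%E ->
    exists2 f : R -> 'rV[R]_d, holder_on01 alpha f &
      (c1%:E * riesz_capacity (d%:R - beta / (alpha + eps)) F <=
       P [set w | [set (B t w + f t)%R | t in E] `&` F !=set0])%E.
Proof.
move=> d0 H01 beta01 al0 eps0; set gamma := d%:R - beta / (alpha + eps).
have /andP[beta0 beta1] := beta01; have /andP[H0 H1] := H01.
have ae0 : 0 < alpha + eps by rewrite addr_gt0.
have gd : gamma <= d%:R by rewrite gerBl divr_ge0// ltW.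
have ratio : alpha * (d%:R - gpos gamma) < beta.
  apply: (@le_lt_trans _ _ (alpha * (beta / (alpha + eps)))).
    rewrite ler_wpM2l ?(ltW al0)//.
    have : gamma <= gpos gamma by rewrite le_max lexx.
    by rewrite {1}/gamma; lra.
  by rewrite mulrA ltr_pdivrMr// mulrC ltr_pM2l//; lra.
(* The constant is chosen before [F]; for [1 <= alpha] no data satisfy the
   hypotheses, as they imply [alpha < H]. *)
have [al1|al1] := ltP alpha 1; last first.
  exists 1 => // disp Omega P B e0 E F _ _ _ _ _ _ _ _ dimF aldim _.
  by have := exponent_lt_hurst H0 beta0 dimF aldim; lra.
have alpha01 : 0 < alpha < 1 by rewrite al0.
have c0 := hit_cst_gt0 M d0 alpha01 ratio.
set c := hit_cst d alpha beta gamma M in c0.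
exists (c / 2); first by rewrite divr_gt0.
move=> disp Omega P B e0 E F Pc fB /andP[e00 e01] Ee cE regE cF FM dimF aldim cap0.
have alH : 0 < alpha < H by rewrite al0 (exponent_lt_hurst H0 beta0 dimF aldim).
have E01 : E `<=` `[0, 1].
  by move=> t /Ee; rewrite /= !in_itv/= => /andP[et ->]; rewrite (le_trans (ltW e00)).
pose energies := [set riesz_energy gamma mu | mu in
  [set mu : probability (borelRd R d) R | mu.-negligible (~` F)]].
have hit (mu : probability (borelRd R d) R) (En : R) :=
  @holder_hit R d H alpha beta gamma M _ _ P B E F mu En
    d0 H01 beta01 alH gd ratio Pc fB E01 cE regE cF FM.
have I0 : (0 <= ereal_inf energies)%E.
  apply: le_ereal_inf_tmp => _ [mu _ <-].
  apply: integral_ge0 => x _; apply: integral_ge0 => y _.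
  exact/riesz_kernel_ge0/enorm_ge0.
move: cap0; rewrite /riesz_capacity -/energies.
case IE : (ereal_inf energies) I0 => [i| |]//; last by rewrite invey ltxx.
rewrite lee_fin => i0 _.
have near En : i < En -> exists2 mu : probability (borelRd R d) R,
    mu.-negligible (~` F) & (riesz_energy gamma mu <= En%:E)%E.
  move=> iEn; have : (ereal_inf energies < En%:E)%E by rewrite IE lte_fin.
  by move=> /ereal_inf_lt[_ [mu muF <-]] /ltW; exists mu.
(* A measure of energy at most [c / 2] would give a hitting probability of at
   least 2. *)
have i_gt0 : 0 < i.
  rewrite lt_neqAle i0 andbT; apply/eqP => i0E.
  have c20 : 0 < c / 2 by rewrite divr_gt0.
  have [mu muF muE] : exists2 mu : probability (borelRd R d) R,
      mu.-negligible (~` F) & (riesz_energy gamma mu <= (c / 2)%:E)%E.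
    by apply: near; rewrite -i0E.
  have [+ _] := hit _ _ muF muE c20.
  by rewrite -/c invf_div mulrA mulrAC divff ?gt_eqF// mul1r; lra.
have i2 : i < 2 * i by lra.
have [mu muF muE] := near _ i2.
have [_ [f fH Pf]] := hit _ _ muF muE (mulr_gt0 (ltr0n _ 2) i_gt0).
exists f => //; apply: le_trans Pf.
rewrite inver gt_eqF// -EFinM lee_fin -/c invfM mulrA.
by rewrite le_eqVlt; apply/orP; left.
Qed.
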